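(* Let $f(z)=z+a_2z^2+a_3z^3+\cdots$ be analytic and univalent in the unit disk $\mathbb{D}=\{z:|z|<1\}$ with $a_2=0$, and let $f^{-1}(w)=w+A_2w^2+A_3w^3+A_4w^4+A_5w^5+\cdots$ be the expansion of its inverse function near $w=0$. Set $H_2(3)(f^{-1})=A_3A_5-A_4^2$. Then $$|H_2(3)(f^{-1})|\le \frac{\sqrt{3}}{6\sqrt{7}}+2\sqrt{3}=3.57321\ldots.$$ *)

(* Defs.v *)
From Stdlib Require Import Reals.
From Coquelicot Require Import Coquelicot.
Open Scope R_scope.

Definition in_unit_disk (z : C) : Prop := Cmod z < 1.

Definition pseries_sum (a : nat -> C) (z l : C) : Prop :=
  is_series (fun n : nat => (a n * z ^ n)%C) l.

Definition analytic_in_disk (a : nat -> C) : Prop :=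
  forall z : C, in_unit_disk z -> exists l : C, pseries_sum a z l.

Definition univalent_in_disk (a : nat -> C) : Prop :=
  forall z w fz fw : C, in_unit_disk z -> in_unit_disk w ->
    pseries_sum a z fz -> pseries_sum a w fw -> fz = fw -> z = w.

Definition is_inverse_expansion (a A : nat -> C) : Prop :=
  exists r : R, 0 < r /\
    forall w : C, Cmod w < r ->
      exists gw : C, pseries_sum A w gw /\ in_unit_disk gw /\ pseries_sum a gw w.

(* Main.v *)
Require Import Defs.
From Stdlib Require Import Reals Lra Lia List.
From Coquelicot Require Import Coquelicot.
Import ListNotations.
Open Scope R_scope.

(* A neutral charge of density [u] on a curve in the plane has nonnegative logarithmic energy:
   after stereographic projection and regularisation, [- ln |p - w|^2] becomes
   [- ln (1 - X) = X + X^2 / 2 + ...] for a Gram kernel [X], up to functions of one variable.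

   Let [f] be univalent on a neighbourhood of the closed disk and transport a charge from the
   circle by [f]. As [|f(z) - f(w)| = |z - w| |G(z, w)|] with [G] free of zeros, the energy is the
   energy on the circle minus the integral of [2 ln |G|]. On each torus diagonal
   [zeta |-> ln |G(x zeta, zeta)|] is harmonic, and its Fourier coefficients are those of
   [log G]. For the charges [cis t + d cis (- n t)], positivity gives [n |gamma_n|^2 <= 1], where
   [gamma_n] is the coefficient of [z w^n] in [log G]; for [a_2 = 0] these are [a_3], [a_4] and
   [a_5 - a_3^2] for [n = 1, 2, 3]. A dilation carries the bounds to the open disk.

   Dividing [f(f^-1(w)) = w] by powers of [w] gives [A_3 = - a_3], [A_4 = - a_4] and
   [A_5 = 3 a_3^2 - a_5], so [A_3 A_5 - A_4^2 = a_3 (a_5 - a_3^2) - 2 a_3^3 - a_4^2], which is at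
   most [1 / sqrt 3 + 2 + 1 / 2] in modulus, and this is below the stated constant. *)

Lemma Cmod_minus_triangle (x y : C) : Cmod (x - y) <= Cmod x + Cmod y.
Proof. unfold Cminus. rewrite <- (Cmod_opp y). apply Cmod_triangle. Qed.

Lemma Cmod_minus_sym (x y : C) : Cmod (x - y) = Cmod (y - x).
Proof. rewrite <- Cmod_opp. f_equal. ring. Qed.

Lemma C_eta (z : C) : (Re z, Im z) = z.
Proof. now destruct z. Qed.

Lemma Cminus_diag_uniq (x y : C) : (x - y)%C = 0 -> x = y.
Proof. intros H. transitivity (x - y + y)%C; [ring|]. rewrite H. ring. Qed.

Lemma Rabs_Im_le_Cmod (z : C) : Rabs (Im z) <= Cmod z.
Proof. eapply Rle_trans; [apply Rmax_r|apply Rmax_Cmod]. Qed.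

Lemma Cmod_le_Re_Im (z : C) : Cmod z <= Rabs (Re z) + Rabs (Im z).
Proof.
  replace z with (RtoC (Re z) + Ci * RtoC (Im z))%C at 1
    by (destruct z; unfold Cplus, Cmult, RtoC, Ci; simpl; f_equal; ring).
  eapply Rle_trans; [apply Cmod_triangle|].
  rewrite Cmod_mult, Cmod_Ci, !Cmod_R. lra.
Qed.

Lemma le_of_vanishing_error (x y K : R) :
  (forall r, 0 < r < 1 -> x <= y + K * (1 - r)) -> x <= y.
Proof.
  intros H. apply Rnot_lt_le. intros L. assert (P := Rabs_pos K). assert (Q := Rle_abs K).
  set (e := Rmin (1 / 2) ((x - y) / (2 * (Rabs K + 1)))).
  assert (E : 0 < e <= 1 / 2).
  { split; [apply Rmin_glb_lt; [lra|apply Rdiv_lt_0_compat; lra]|apply Rmin_l]. }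
  assert (B : e * (2 * (Rabs K + 1)) <= x - y).
  { apply Rle_trans with ((x - y) / (2 * (Rabs K + 1)) * (2 * (Rabs K + 1))).
    - apply Rmult_le_compat_r; [lra|apply Rmin_r].
    - right. field. lra. }
  specialize (H (1 - e) ltac:(lra)). nra.
Qed.

(** * Complex series *)

Lemma ex_series_bounded (u : nat -> R) :
  ex_series u -> exists M, forall n, Rabs (u n) <= M.
Proof.
  intros H. destruct (filterlim_bounded u) as [M HM]; [|now exists M].
  exists 0. exact (ex_series_lim_0 u H).
Qed.

Lemma is_series_C_iff (u : nat -> C) (l : C) :
  is_series (K := C_AbsRing) (V := C_NormedModule) u l <->
  is_series (fun n => Re (u n)) (Re l) /\ is_series (fun n => Im (u n)) (Im l).
Proof.
  assert (E : forall n, sum_n (G := C_NormedModule) u n =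
    (sum_n (fun n => Re (u n)) n, sum_n (fun n => Im (u n)) n)).
  { induction n as [|n IH].
    - rewrite !sum_O. now destruct (u 0%nat).
    - rewrite !sum_Sn, IH. reflexivity. }
  unfold is_series. split.
  - intros H. split; apply filterlim_locally; intros eps;
      assert (H' := proj1 (filterlim_locally _ _) H eps);
      revert H'; apply filter_imp; intros n; rewrite E; now intros [HRe HIm].
  - intros [HRe HIm]. apply filterlim_locally; intros eps.
    assert (NearRe := proj1 (filterlim_locally _ _) HRe eps).
    assert (NearIm := proj1 (filterlim_locally _ _) HIm eps).
    generalize (filter_and _ _ NearRe NearIm). apply filter_imp. intros n Hn. rewrite E.
    exact Hn.
Qed.

Definition csum (u : nat -> C) : C :=
  (Series (fun n => Re (u n)), Series (fun n => Im (u n))).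

Definition abs_summable (u : nat -> C) : Prop := ex_series (fun n => Cmod (u n)).

Lemma abs_summable_le (u : nat -> C) (b : nat -> R) :
  (forall n, Cmod (u n) <= b n) -> ex_series b -> abs_summable u.
Proof.
  intros H. apply (ex_series_le (V := R_CompleteNormedModule)). intros n.
  change (Rabs (Cmod (u n)) <= b n). rewrite Rabs_pos_eq by apply Cmod_ge_0. apply H.
Qed.

Lemma abs_summable_Re (u : nat -> C) : abs_summable u -> ex_series (fun n => Rabs (Re (u n))).
Proof.
  apply (ex_series_le (V := R_CompleteNormedModule)). intros n.
  change (Rabs (Rabs (Re (u n))) <= Cmod (u n)). rewrite Rabs_Rabsolu. apply re_le_Cmod.
Qed.

Lemma abs_summable_Im (u : nat -> C) : abs_summable u -> ex_series (fun n => Rabs (Im (u n))).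
Proof.
  apply (ex_series_le (V := R_CompleteNormedModule)). intros n.
  change (Rabs (Rabs (Im (u n))) <= Cmod (u n)). rewrite Rabs_Rabsolu. apply Rabs_Im_le_Cmod.
Qed.

Lemma csum_correct (u : nat -> C) : abs_summable u ->
  is_series (K := C_AbsRing) (V := C_NormedModule) u (csum u).
Proof.
  intros H. apply is_series_C_iff. split; apply Series_correct, ex_series_Rabs.
  - now apply abs_summable_Re.
  - now apply abs_summable_Im.
Qed.

Lemma csum_unique (u : nat -> C) (l : C) :
  is_series (K := C_AbsRing) (V := C_NormedModule) u l -> csum u = l.
Proof.
  intros H. apply is_series_C_iff in H. destruct H as [HRe HIm].
  unfold csum. rewrite (is_series_unique _ _ HRe), (is_series_unique _ _ HIm). now destruct l.
Qed.

Lemma csum_ext (u v : nat -> C) : (forall n, u n = v n) -> csum u = csum v.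
Proof. intros H. unfold csum. f_equal; apply Series_ext; intros n; now rewrite H. Qed.

Lemma csum_0 (u : nat -> C) : (forall n, u n = 0) -> csum u = 0.
Proof.
  intros H. unfold csum, RtoC. f_equal;
    (rewrite (Series_ext _ (fun n => 0 * 0)) by (intros n; rewrite H; simpl; ring);
     rewrite Series_scal_l; ring).
Qed.

Lemma csum_scal (c : C) (u : nat -> C) : abs_summable u ->
  csum (fun n => c * u n)%C = (c * csum u)%C.
Proof.
  intros H. apply csum_unique.
  exact (is_series_scal_l (K := C_AbsRing) c u _ (csum_correct u H)).
Qed.

Lemma csum_minus (u v : nat -> C) : abs_summable u -> abs_summable v ->
  csum (fun n => u n - v n)%C = (csum u - csum v)%C.
Proof.
  intros Hu Hv. apply csum_unique.
  exact (is_series_minus (K := C_AbsRing) (V := C_NormedModule) u v _ _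
    (csum_correct u Hu) (csum_correct v Hv)).
Qed.

Lemma csum_incr_1 (u : nat -> C) : abs_summable u ->
  csum u = (u 0%nat + csum (fun n => u (S n)))%C.
Proof.
  intros H. unfold csum, Cplus; simpl. f_equal; apply Series_incr_1, ex_series_Rabs.
  - now apply abs_summable_Re.
  - now apply abs_summable_Im.
Qed.

Lemma Cmod_csum_le (u : nat -> C) (b : nat -> R) :
  (forall n, Cmod (u n) <= b n) -> ex_series b -> Cmod (csum u) <= 2 * Series b.
Proof.
  intros H Hb. assert (Hu := abs_summable_le u b H Hb).
  assert (HRe : Rabs (Series (fun n => Re (u n))) <= Series b).
  { eapply Rle_trans; [apply Series_Rabs, abs_summable_Re, Hu|].
    apply Series_le; auto. intros n. split; [apply Rabs_pos|].
    eapply Rle_trans; [apply re_le_Cmod|apply H]. }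
  assert (HIm : Rabs (Series (fun n => Im (u n))) <= Series b).
  { eapply Rle_trans; [apply Series_Rabs, abs_summable_Im, Hu|].
    apply Series_le; auto. intros n. split; [apply Rabs_pos|].
    eapply Rle_trans; [apply Rabs_Im_le_Cmod|apply H]. }
  eapply Rle_trans; [apply Cmod_le_Re_Im|]. simpl. lra.
Qed.

(** * Power series *)

Definition convergent_on_disk (rho : R) (a : nat -> C) : Prop :=
  forall r, 0 <= r < rho -> ex_series (fun n => Cmod (a n) * r ^ n).

Definition ps (a : nat -> C) (z : C) : C := csum (fun n => a n * z ^ n)%C.

Definition shift (a : nat -> C) (n : nat) : C := a (S n).

Definition nmul (a : nat -> C) (n : nat) : C := (INR n * a n)%C.

Definition deriv_seq (a : nat -> C) : nat -> C := shift (nmul a).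

Lemma convergent_on_disk_le (rho : R) (a b : nat -> C) :
  (forall n, Cmod (a n) <= Cmod (b n)) -> convergent_on_disk rho b -> convergent_on_disk rho a.
Proof.
  intros H Hb r Hr. assert (P : forall n, 0 <= r ^ n) by (intros n; apply pow_le; lra).
  apply (ex_series_le (V := R_CompleteNormedModule) _ (fun n => Cmod (b n) * r ^ n)); auto.
  intros n. change (Rabs (Cmod (a n) * r ^ n) <= Cmod (b n) * r ^ n).
  rewrite Rabs_pos_eq by (apply Rmult_le_pos; auto using Cmod_ge_0).
  now apply Rmult_le_compat_r.
Qed.

Lemma convergent_on_disk_lt_radius (rho r : R) (a : nat -> C) :
  (forall s, 0 <= s < rho -> exists M, forall n, Cmod (a n) * s ^ n <= M) -> 0 <= r < rho ->
  Rbar_lt (Rabs r) (CV_radius (fun n => Cmod (a n))).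
Proof.
  intros H Hr. rewrite Rabs_pos_eq by lra.
  apply Rbar_lt_le_trans with ((r + rho) / 2); [simpl; lra|].
  destruct (H ((r + rho) / 2)) as [M HM]; [lra|].
  apply (CV_radius_bounded (fun n => Cmod (a n))). exists M. intros n.
  rewrite Rabs_pos_eq; auto.
  apply Rmult_le_pos; [apply Cmod_ge_0|apply pow_le; lra].
Qed.

Lemma convergent_on_disk_of_bounded (rho : R) (a : nat -> C) :
  (forall s, 0 <= s < rho -> exists M, forall n, Cmod (a n) * s ^ n <= M) ->
  convergent_on_disk rho a.
Proof.
  intros H r Hr.
  apply (ex_series_Rabs (fun n => Cmod (a n) * r ^ n)), CV_disk_inside.
  now apply convergent_on_disk_lt_radius with rho.
Qed.

Lemma convergent_on_disk_bounded (rho r : R) (a : nat -> C) :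
  convergent_on_disk rho a -> 0 <= r < rho -> exists M, forall n, Cmod (a n) * r ^ n <= M.
Proof.
  intros H Hr. destruct (ex_series_bounded _ (H r Hr)) as [M HM].
  exists M. intros n. eapply Rle_trans; [apply Rle_abs|apply HM].
Qed.

Lemma convergent_on_disk_deriv (rho : R) (a : nat -> C) :
  convergent_on_disk rho a -> convergent_on_disk rho (deriv_seq a).
Proof.
  intros H r Hr.
  assert (L : Rbar_lt (Rabs r) (CV_radius (PS_derive (fun n => Cmod (a n))))).
  { rewrite CV_radius_derive. apply convergent_on_disk_lt_radius with rho; auto.
    intros s. now apply convergent_on_disk_bounded. }
  apply CV_disk_inside, ex_series_Rabs in L. revert L. apply ex_series_ext. intros n.
  unfold PS_derive, deriv_seq, shift, nmul.
  now rewrite Cmod_mult, Cmod_R, Rabs_pos_eq by apply pos_INR.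
Qed.

Lemma convergent_on_disk_shift (rho : R) (a : nat -> C) :
  convergent_on_disk rho a -> convergent_on_disk rho (shift a).
Proof.
  intros H. apply convergent_on_disk_le with (deriv_seq a); [|now apply convergent_on_disk_deriv].
  intros n. unfold deriv_seq, shift, nmul.
  rewrite Cmod_mult, Cmod_R, Rabs_pos_eq by apply pos_INR.
  assert (P := Cmod_ge_0 (a (S n))). assert (N := pos_INR n). rewrite S_INR. nra.
Qed.

Lemma convergent_on_disk_nmul (rho : R) (a : nat -> C) :
  convergent_on_disk rho a -> convergent_on_disk rho (nmul a).
Proof.
  intros H r Hr. apply ex_series_incr_1.
  apply (ex_series_ext (fun n => r * (Cmod (deriv_seq a n) * r ^ n))).
  - intros n. unfold deriv_seq, shift. simpl. ring.
  - apply (ex_series_scal (V := R_NormedModule)). exact (convergent_on_disk_deriv rho a H r Hr).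
Qed.

Lemma convergent_on_disk_minus_scal (rho : R) (a b : nat -> C) (c : C) :
  convergent_on_disk rho a -> convergent_on_disk rho b ->
  convergent_on_disk rho (fun n => a n - c * b n)%C.
Proof.
  intros Ha Hb r Hr. assert (P : forall n, 0 <= r ^ n) by (intros n; apply pow_le; lra).
  apply (ex_series_le (V := R_CompleteNormedModule) _
    (fun n => Cmod (a n) * r ^ n + Cmod c * (Cmod (b n) * r ^ n))).
  - intros n.
    change (Rabs (Cmod (a n - c * b n) * r ^ n) <=
      Cmod (a n) * r ^ n + Cmod c * (Cmod (b n) * r ^ n)).
    rewrite Rabs_pos_eq by (apply Rmult_le_pos; auto using Cmod_ge_0).
    rewrite <- Rmult_assoc, <- Rmult_plus_distr_r, <- Cmod_mult.
    apply Rmult_le_compat_r; [apply P|apply Cmod_minus_triangle].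
  - apply (ex_series_plus (V := R_NormedModule)); [now apply Ha|].
    apply (ex_series_scal (V := R_NormedModule)). now apply Hb.
Qed.

Lemma ps_abs_summable (rho : R) (a : nat -> C) (z : C) : convergent_on_disk rho a -> Cmod z < rho ->
  abs_summable (fun n => a n * z ^ n)%C.
Proof.
  intros H Hz. apply abs_summable_le with (fun n => Cmod (a n) * Cmod z ^ n).
  - intros n. rewrite Cmod_mult, Cmod_pow. lra.
  - apply H. split; [apply Cmod_ge_0|exact Hz].
Qed.

Lemma ps_bound (rho r : R) (a : nat -> C) : convergent_on_disk rho a -> 0 <= r < rho ->
  exists M, forall z, Cmod z <= r -> Cmod (ps a z) <= M.
Proof.
  intros H Hr. exists (2 * Series (fun n => Cmod (a n) * r ^ n)). intros z Hz.
  apply Cmod_csum_le; [|now apply H]. intros n. rewrite Cmod_mult, Cmod_pow.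
  apply Rmult_le_compat_l; [apply Cmod_ge_0|]. apply pow_incr. split; [apply Cmod_ge_0|exact Hz].
Qed.

Lemma ps_correct (rho : R) (a : nat -> C) (z : C) : convergent_on_disk rho a -> Cmod z < rho ->
  pseries_sum a z (ps a z).
Proof. intros H Hz. now apply csum_correct, ps_abs_summable with rho. Qed.

Lemma ps_unfold (rho : R) (a : nat -> C) (z : C) : convergent_on_disk rho a -> Cmod z < rho ->
  ps a z = (a 0%nat + z * ps (shift a) z)%C.
Proof.
  intros H Hz. unfold ps. rewrite csum_incr_1 by now apply ps_abs_summable with rho.
  f_equal; [simpl; ring|].
  rewrite <- csum_scal.
  - apply csum_ext. intros n. unfold shift. simpl. ring.
  - apply ps_abs_summable with rho; auto. now apply convergent_on_disk_shift.
Qed.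

Lemma ps_at_0 (rho : R) (a : nat -> C) : 0 < rho -> convergent_on_disk rho a -> ps a 0 = a 0%nat.
Proof. intros Hrho H. rewrite (ps_unfold rho) by (rewrite ?Cmod_0; auto). ring. Qed.

Lemma ps_minus_scal (rho : R) (a b : nat -> C) (c z : C) :
  convergent_on_disk rho a -> convergent_on_disk rho b -> Cmod z < rho ->
  ps (fun n => a n - c * b n)%C z = (ps a z - c * ps b z)%C.
Proof.
  intros Ha Hb Hz. unfold ps. rewrite <- csum_scal by now apply ps_abs_summable with rho.
  rewrite <- csum_minus.
  - apply csum_ext. intros n. ring.
  - now apply ps_abs_summable with rho.
  - apply abs_summable_le with (fun n => Cmod c * Cmod (b n * z ^ n)%C).
    + intros n. rewrite Cmod_mult. lra.
    + apply (ex_series_scal (V := R_NormedModule)). now apply ps_abs_summable with rho.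
Qed.

Lemma ps_nmul (rho : R) (a : nat -> C) (z : C) : convergent_on_disk rho a -> Cmod z < rho ->
  ps (nmul a) z = (z * ps (deriv_seq a) z)%C.
Proof.
  intros H Hz. rewrite (ps_unfold rho) by (auto using convergent_on_disk_nmul).
  unfold deriv_seq, nmul at 1. simpl. ring.
Qed.

Lemma convergent_on_disk_of_pseries_sum (rho : R) (a : nat -> C) :
  (forall z, Cmod z < rho -> exists l, pseries_sum a z l) -> convergent_on_disk rho a.
Proof.
  intros H. apply convergent_on_disk_of_bounded. intros r Hr.
  destruct (H (RtoC r)) as [l Hl]; [rewrite Cmod_R, Rabs_pos_eq; lra|].
  apply is_series_C_iff in Hl. destruct Hl as [HRe HIm].
  destruct (ex_series_bounded _ (ex_intro _ _ HRe)) as [M1 HM1].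
  destruct (ex_series_bounded _ (ex_intro _ _ HIm)) as [M2 HM2].
  exists (M1 + M2). intros n.
  replace (Cmod (a n) * r ^ n) with (Cmod (a n * RtoC r ^ n))
    by (rewrite Cmod_mult, Cmod_pow, Cmod_R, Rabs_pos_eq; lra).
  eapply Rle_trans; [apply Cmod_le_Re_Im|]. generalize (HM1 n) (HM2 n). simpl. lra.
Qed.

(** * Difference quotients of power series *)

Fixpoint power_quotient (k : nat) (z w : C) : C :=
  match k with
  | O => 1
  | S k => (z * power_quotient k z w + w ^ S k)%C
  end.

Definition diff_quotient (a : nat -> C) (z w : C) : C :=
  csum (fun k => a (S k) * power_quotient k z w)%C.

Lemma power_quotient_spec (k : nat) (z w : C) :
  ((z - w) * power_quotient k z w = z ^ S k - w ^ S k)%C.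
Proof.
  induction k as [|k IH]; [simpl; ring|].
  transitivity (z * ((z - w) * power_quotient k z w) + (z - w) * w ^ S k)%C; [simpl; ring|].
  rewrite IH. simpl. ring.
Qed.

Lemma power_quotient_S_r (k : nat) (z w : C) :
  power_quotient (S k) z w = (w * power_quotient k z w + z ^ S k)%C.
Proof.
  transitivity (w * power_quotient k z w + ((z - w) * power_quotient k z w + w ^ S k))%C.
  - simpl. ring.
  - rewrite power_quotient_spec. simpl. ring.
Qed.

Lemma power_quotient_sym (k : nat) (z w : C) : power_quotient k z w = power_quotient k w z.
Proof.
  induction k as [|k IH]; [reflexivity|]. rewrite power_quotient_S_r, IH. reflexivity.
Qed.

Lemma power_quotient_diag (k : nat) (z : C) : power_quotient k z z = (INR (S k) * z ^ k)%C.
Proof.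
  induction k as [|k IH]; [simpl; ring|].
  rewrite S_INR, RtoC_plus. simpl power_quotient. rewrite IH. simpl. ring.
Qed.

Lemma power_quotient_scal (k : nat) (x z : C) :
  power_quotient k (x * z) z = (power_quotient k x 1 * z ^ k)%C.
Proof.
  induction k as [|k IH]; [simpl; ring|].
  simpl power_quotient. rewrite IH, Cpow_1_l. simpl. ring.
Qed.

Lemma power_quotient_bound (k : nat) (z w : C) (r : R) : 0 <= r -> Cmod z <= r -> Cmod w <= r ->
  Cmod (power_quotient k z w) <= INR (S k) * r ^ k.
Proof.
  intros Hr Hz Hw. induction k as [|k IH]; [simpl; rewrite Cmod_1; lra|].
  simpl power_quotient. eapply Rle_trans; [apply Cmod_triangle|].
  change (w * w ^ k)%C with (w ^ S k)%C.
  rewrite Cmod_mult, Cmod_pow, (S_INR (S k)).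
  assert (W : Cmod w ^ S k <= r ^ S k) by (apply pow_incr; auto using Cmod_ge_0).
  assert (Z : Cmod z * Cmod (power_quotient k z w) <= r * (INR (S k) * r ^ k))
    by (apply Rmult_le_compat; auto using Cmod_ge_0).
  change (r ^ S k) with (r * r ^ k) in *. lra.
Qed.

Lemma power_quotient_lipschitz (k : nat) (z z' w : C) (r : R) :
  0 <= r -> Cmod z <= r -> Cmod z' <= r -> Cmod w <= r ->
  Cmod (power_quotient (S k) z w - power_quotient (S k) z' w)
    <= INR (S k) * INR (S (S k)) * r ^ k * Cmod (z - z').
Proof.
  intros Hr Hz Hz' Hw. assert (D := Cmod_ge_0 (z - z')).
  induction k as [|k IH].
  { simpl. replace (z * 1 + w * 1 - (z' * 1 + w * 1))%C with (z - z')%C by ring. lra. }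
  replace (power_quotient (S (S k)) z w - power_quotient (S (S k)) z' w)%C
    with ((z - z') * power_quotient (S k) z w
      + z' * (power_quotient (S k) z w - power_quotient (S k) z' w))%C
    by (change (power_quotient (S (S k)) z w) with (z * power_quotient (S k) z w + w ^ S (S k))%C;
        change (power_quotient (S (S k)) z' w)
          with (z' * power_quotient (S k) z' w + w ^ S (S k))%C;
        ring).
  eapply Rle_trans; [apply Cmod_triangle|]. rewrite !Cmod_mult.
  assert (B : Cmod (z - z') * Cmod (power_quotient (S k) z w)
      <= Cmod (z - z') * (INR (S (S k)) * r ^ S k))
    by (apply Rmult_le_compat_l; [exact D|now apply power_quotient_bound]).
  assert (L := Rmult_le_compat _ _ _ _ (Cmod_ge_0 z') (Cmod_ge_0 _) Hz' IH).
  rewrite !S_INR in *. change (r ^ S k) with (r * r ^ k) in *.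
  assert (N := pos_INR k). assert (P : 0 <= r * r ^ k * Cmod (z - z')).
  { apply Rmult_le_pos; [apply Rmult_le_pos; [|apply pow_le]|]; auto. }
  nra.
Qed.

Section diff_quotient.
Variables (rho : R) (a : nat -> C).
Hypothesis Ha : convergent_on_disk rho a.

Lemma diff_quotient_bound (r : R) : 0 <= r < rho ->
  exists M, forall z w, Cmod z <= r -> Cmod w <= r -> Cmod (diff_quotient a z w) <= M.
Proof.
  intros Hr. exists (2 * Series (fun k => Cmod (deriv_seq a k) * r ^ k)). intros z w Hz Hw.
  apply Cmod_csum_le; [|exact (convergent_on_disk_deriv rho a Ha r Hr)].
  intros k. unfold deriv_seq, shift, nmul.
  rewrite !Cmod_mult, Cmod_R, Rabs_pos_eq by apply pos_INR.
  rewrite (Rmult_comm (INR _)), Rmult_assoc. apply Rmult_le_compat_l; [apply Cmod_ge_0|].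
  apply power_quotient_bound; auto; lra.
Qed.

Lemma diff_quotient_abs_summable (z w : C) : Cmod z < rho -> Cmod w < rho ->
  abs_summable (fun k => a (S k) * power_quotient k z w)%C.
Proof.
  intros Hz Hw. set (r := Rmax (Cmod z) (Cmod w)).
  assert (Hr : 0 <= r < rho)
    by (split; [eapply Rle_trans; [apply (Cmod_ge_0 z)|apply Rmax_l]|now apply Rmax_lub_lt]).
  apply abs_summable_le with (fun k => Cmod (deriv_seq a k) * r ^ k);
    [|exact (convergent_on_disk_deriv rho a Ha r Hr)].
  intros k. unfold deriv_seq, shift, nmul.
  rewrite !Cmod_mult, Cmod_R, Rabs_pos_eq by apply pos_INR.
  rewrite (Rmult_comm (INR _)), Rmult_assoc. apply Rmult_le_compat_l; [apply Cmod_ge_0|].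
  apply power_quotient_bound; [lra|apply Rmax_l|apply Rmax_r].
Qed.

Lemma diff_quotient_spec (z w : C) : Cmod z < rho -> Cmod w < rho ->
  ((z - w) * diff_quotient a z w = ps a z - ps a w)%C.
Proof.
  intros Hz Hw. unfold diff_quotient. rewrite <- csum_scal by now apply diff_quotient_abs_summable.
  rewrite !(ps_unfold rho a) by assumption.
  transitivity (z * ps (shift a) z - w * ps (shift a) w)%C; [|ring].
  assert (S1 := ps_abs_summable rho _ z (convergent_on_disk_shift rho a Ha) Hz).
  assert (S2 := ps_abs_summable rho _ w (convergent_on_disk_shift rho a Ha) Hw).
  unfold ps. rewrite <- !csum_scal, <- csum_minus by
    (assumption || (eapply abs_summable_le; [intros n; rewrite Cmod_mult; apply Rle_refl|
      apply (ex_series_scal (V := R_NormedModule)); assumption])).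
  apply csum_ext. intros n. unfold shift.
  transitivity (a (S n) * ((z - w) * power_quotient n z w))%C; [ring|].
  rewrite power_quotient_spec. simpl. ring.
Qed.

Lemma diff_quotient_sym (z w : C) : diff_quotient a z w = diff_quotient a w z.
Proof. apply csum_ext. intros k. now rewrite power_quotient_sym. Qed.

Lemma diff_quotient_diag (z : C) : diff_quotient a z z = ps (deriv_seq a) z.
Proof.
  apply csum_ext. intros k. rewrite power_quotient_diag.
  unfold deriv_seq, shift, nmul. ring.
Qed.

Lemma diff_quotient_scal (x z : C) :
  diff_quotient a (x * z) z = ps (fun k => a (S k) * power_quotient k x 1)%C z.
Proof. apply csum_ext. intros k. rewrite power_quotient_scal. ring. Qed.

Lemma convergent_on_disk_diff_quotient (x : C) : Cmod x <= 1 ->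
  convergent_on_disk rho (fun k => a (S k) * power_quotient k x 1)%C.
Proof.
  intros Hx. apply convergent_on_disk_le with (deriv_seq a);
    [|now apply convergent_on_disk_deriv].
  intros k. unfold deriv_seq, shift, nmul.
  rewrite !Cmod_mult, Cmod_R, Rabs_pos_eq by apply pos_INR. rewrite Rmult_comm.
  apply Rmult_le_compat_r; [apply Cmod_ge_0|].
  replace (INR (S k)) with (INR (S k) * 1 ^ k) by (rewrite pow1; ring).
  apply power_quotient_bound; rewrite ?Cmod_1; lra.
Qed.

Lemma diff_quotient_lipschitz (r : R) : 0 <= r < rho ->
  exists L, 0 <= L /\ forall z z' w, Cmod z <= r -> Cmod z' <= r -> Cmod w <= r ->
    Cmod (diff_quotient a z w - diff_quotient a z' w) <= L * Cmod (z - z').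
Proof.
  intros Hr. set (b := fun k => Cmod (deriv_seq (deriv_seq a) k) * r ^ k).
  assert (Hb : ex_series b)
    by (refine (convergent_on_disk_deriv rho _ _ r Hr); now apply convergent_on_disk_deriv).
  assert (B : forall z z' w, Cmod z <= r -> Cmod z' <= r -> Cmod w <= r ->
    Cmod (diff_quotient a z w - diff_quotient a z' w) <= 2 * (Series b * Cmod (z - z'))).
  { intros z z' w Hz Hz' Hw. unfold diff_quotient.
    rewrite <- csum_minus by (apply diff_quotient_abs_summable; lra).
    rewrite csum_incr_1; simpl power_quotient.
    2:{ apply abs_summable_le with (fun k => Cmod (a (S k) * power_quotient k z w)%C
          + Cmod (a (S k) * power_quotient k z' w)%C).
        - intros k. apply Cmod_minus_triangle.
        - apply (ex_series_plus (V := R_NormedModule)); apply diff_quotient_abs_summable; lra. }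
    rewrite <- Series_scal_r.
    replace (a 1%nat * 1 - a 1%nat * 1)%C with (RtoC 0) by ring. rewrite Cplus_0_l.
    apply Cmod_csum_le.
    - intros k. change (z * power_quotient k z w + w * w ^ k)%C with (power_quotient (S k) z w).
      change (z' * power_quotient k z' w + w * w ^ k)%C with (power_quotient (S k) z' w).
      replace (a (S (S k)) * power_quotient (S k) z w - a (S (S k)) * power_quotient (S k) z' w)%C
        with (a (S (S k)) * (power_quotient (S k) z w - power_quotient (S k) z' w))%C by ring.
      unfold b, deriv_seq, shift, nmul.
      rewrite !Cmod_mult, !Cmod_R, !Rabs_pos_eq by apply pos_INR.
      assert (P := power_quotient_lipschitz k z z' w r ltac:(lra) Hz Hz' Hw).
      apply (Rmult_le_compat_l (Cmod (a (S (S k))))) in P; [lra|apply Cmod_ge_0].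
    - now apply ex_series_scal_r. }
  exists (2 * Rabs (Series b)). split; [generalize (Rabs_pos (Series b)); lra|].
  intros z z' w Hz Hz' Hw. eapply Rle_trans; [now apply B|].
  generalize (Rle_abs (Series b)) (Cmod_ge_0 (z - z')). nra.
Qed.

End diff_quotient.

(** * Holomorphic functions *)

(* The library states derivatives over [C] for the uniform structure of the absolute
   ring [C], which has the modulus discs as balls, not for the product structure. *)
Notation C_Uniform := (AbsRing_UniformSpace C_AbsRing).

Notation is_C_derive := (is_derive (K := C_AbsRing) (V := AbsRing_NormedModule C_AbsRing)).

Notation C_continuous := (continuous (U := C_Uniform)).

Notation CC_continuous := (continuous (T := C_Uniform) (U := C_Uniform)).

Lemma is_C_derive_iff (f : C -> C) (z l : C) :
  is_C_derive f z l <-> forall eps : posreal, locally (T := C_Uniform) z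
    (fun w => Cmod (f w - f z - (w - z) * l) <= eps * Cmod (w - z)).
Proof.
  split.
  - intros [_ H]. exact (H z (fun P HP => HP)).
  - intros H. split; [exact (is_linear_scal_l (V := AbsRing_NormedModule C_AbsRing) l)|].
    intros x Hx.
    apply (is_filter_lim_locally_unique (V := AbsRing_NormedModule C_AbsRing)) in Hx.
    rewrite <- Hx. exact H.
Qed.

Lemma is_C_derive_of_quadratic (f : C -> C) (z l : C) (K d : R) : 0 <= K -> 0 < d ->
  (forall w, Cmod (w - z) < d -> Cmod (f w - f z - (w - z) * l) <= K * Cmod (w - z) ^ 2) ->
  is_C_derive f z l.
Proof.
  intros HK Hd H. apply is_C_derive_iff. intros eps. assert (He := cond_pos eps).
  assert (Hr : 0 < Rmin d (eps / (K + 1)))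
    by (apply Rmin_glb_lt; [exact Hd|apply Rdiv_lt_0_compat; lra]).
  exists (mkposreal _ Hr). intros w Hw. change (Cmod (w - z) < Rmin d (eps / (K + 1))) in Hw.
  assert (B1 := Rmin_l d (eps / (K + 1))). assert (B2 := Rmin_r d (eps / (K + 1))).
  eapply Rle_trans; [apply H; lra|]. assert (P := Cmod_ge_0 (w - z)).
  assert (B3 : Cmod (w - z) * (K + 1) <= eps).
  { apply Rle_trans with (eps / (K + 1) * (K + 1)); [apply Rmult_le_compat_r; lra|].
    right. field. lra. }
  replace (K * Cmod (w - z) ^ 2) with (K * Cmod (w - z) * Cmod (w - z)) by ring.
  apply Rmult_le_compat_r; nra.
Qed.

Lemma is_C_derive_continuous (f : C -> C) (z l : C) :
  is_C_derive f z l -> CC_continuous f z.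
Proof.
  intros H.
  apply (ex_derive_continuous (K := C_AbsRing) (V := AbsRing_NormedModule C_AbsRing)).
  now exists l.
Qed.

Lemma is_C_derive_mult (f g : C -> C) (z l m : C) : is_C_derive f z l -> is_C_derive g z m ->
  is_C_derive (fun w => f w * g w)%C z (l * g z + f z * m)%C.
Proof.
  intros Hf Hg. exact (is_derive_mult (K := C_AbsRing) f g z l m Hf Hg Cmult_comm).
Qed.

Lemma is_C_derive_Cinv (z : C) : z <> 0 -> is_C_derive Cinv z (- / (z * z))%C.
Proof.
  intros Hz. assert (P : 0 < Cmod z) by now apply Cmod_gt_0.
  apply (is_C_derive_of_quadratic _ z _ (2 / Cmod z ^ 3) (Cmod z / 2)).
  - left. apply Rdiv_lt_0_compat; [lra|now apply pow_lt].
  - lra.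
  - intros w Hw.
    assert (W : Cmod z / 2 <= Cmod w).
    { generalize (Cmod_triangle w (z - w)). rewrite Cmod_minus_sym in Hw.
      replace (w + (z - w))%C with z by ring. lra. }
    assert (Hw0 : w <> 0) by (apply Cmod_gt_0; lra).
    replace (/ w - / z - (w - z) * - / (z * z))%C with ((w - z) * (w - z) / (z * z * w))%C
      by (field; auto).
    rewrite Cmod_div by (repeat apply Cmult_neq_0; auto). rewrite !Cmod_mult.
    replace (2 / Cmod z ^ 3 * Cmod (w - z) ^ 2)
      with (Cmod (w - z) * Cmod (w - z) * / (Cmod z * Cmod z * (Cmod z / 2))) by (field; lra).
    apply Rmult_le_compat_l; [apply Rmult_le_pos; apply Cmod_ge_0|].
    apply Rinv_le_contravar; [repeat apply Rmult_lt_0_compat; lra|].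
    apply Rmult_le_compat_l; [apply Rmult_le_pos|]; lra.
Qed.

Lemma is_C_derive_inv (f : C -> C) (z l : C) : f z <> 0 -> is_C_derive f z l ->
  is_C_derive (fun w => / f w)%C z (l * - / (f z * f z))%C.
Proof.
  intros Hz Hf.
  exact (is_derive_comp (K := C_AbsRing) (V := AbsRing_NormedModule C_AbsRing)
    Cinv f z _ l (is_C_derive_Cinv (f z) Hz) Hf).
Qed.

Lemma C_continuous_const {T : UniformSpace} (c : C) (x : T) : C_continuous (fun _ => c) x.
Proof. exact (continuous_const (V := C_Uniform) c x). Qed.

Lemma C_continuous_mult {T : UniformSpace} (f g : T -> C) (x : T) :
  C_continuous f x -> C_continuous g x -> C_continuous (fun y => f y * g y)%C x.
Proof. exact (continuous_mult (K := C_AbsRing) f g x). Qed.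

Lemma C_continuous_plus {T : UniformSpace} (f g : T -> C) (x : T) :
  C_continuous f x -> C_continuous g x -> C_continuous (fun y => f y + g y)%C x.
Proof. exact (continuous_plus (V := AbsRing_NormedModule C_AbsRing) f g x). Qed.

Lemma C_continuous_minus {T : UniformSpace} (f g : T -> C) (x : T) :
  C_continuous f x -> C_continuous g x -> C_continuous (fun y => f y - g y)%C x.
Proof. exact (continuous_minus (V := AbsRing_NormedModule C_AbsRing) f g x). Qed.

Lemma C_continuous_inv {T : UniformSpace} (f : T -> C) (x : T) :
  f x <> 0 -> C_continuous f x -> C_continuous (fun y => / f y)%C x.
Proof.
  intros Hx Hf. apply (continuous_comp (V := C_Uniform) (W := C_Uniform) f Cinv); [exact Hf|].
  now apply is_C_derive_continuous with (- / (f x * f x))%C, is_C_derive_Cinv.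
Qed.

Definition holomorphic (rho : R) (f : C -> C) : Prop :=
  exists f' : C -> C, forall z, Cmod z < rho ->
    is_C_derive f z (f' z) /\ CC_continuous f' z.

Lemma holomorphic_continuous (rho : R) (f : C -> C) (z : C) :
  holomorphic rho f -> Cmod z < rho -> CC_continuous f z.
Proof.
  intros [f' H] Hz. now apply is_C_derive_continuous with (f' z), H.
Qed.

Lemma holomorphic_const (rho : R) (c : C) : holomorphic rho (fun _ => c).
Proof.
  exists (fun _ => RtoC 0). intros z _. split.
  - exact (is_derive_const (K := C_AbsRing) (V := AbsRing_NormedModule C_AbsRing) c z).
  - apply (C_continuous_const (T := C_Uniform)).
Qed.

Lemma holomorphic_id (rho : R) : holomorphic rho (fun z => z).
Proof.
  exists (fun _ => RtoC 1). intros z _. split.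
  - exact (is_derive_id (K := C_AbsRing) z).
  - apply (C_continuous_const (T := C_Uniform)).
Qed.

Lemma holomorphic_plus (rho : R) (f g : C -> C) :
  holomorphic rho f -> holomorphic rho g -> holomorphic rho (fun z => f z + g z)%C.
Proof.
  intros [f' Hf] [g' Hg]. exists (fun z => f' z + g' z)%C. intros z Hz.
  destruct (Hf z Hz), (Hg z Hz). split; [|now apply (C_continuous_plus (T := C_Uniform))].
  now apply (is_derive_plus (K := C_AbsRing) (V := AbsRing_NormedModule C_AbsRing)).
Qed.

Lemma holomorphic_minus (rho : R) (f g : C -> C) :
  holomorphic rho f -> holomorphic rho g -> holomorphic rho (fun z => f z - g z)%C.
Proof.
  intros [f' Hf] [g' Hg]. exists (fun z => f' z - g' z)%C. intros z Hz.
  destruct (Hf z Hz), (Hg z Hz). split; [|now apply (C_continuous_minus (T := C_Uniform))].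
  now apply (is_derive_minus (K := C_AbsRing) (V := AbsRing_NormedModule C_AbsRing)).
Qed.

Lemma holomorphic_mult (rho : R) (f g : C -> C) :
  holomorphic rho f -> holomorphic rho g -> holomorphic rho (fun z => f z * g z)%C.
Proof.
  intros Hf Hg. assert (Cf := fun z => holomorphic_continuous rho f z Hf).
  assert (Cg := fun z => holomorphic_continuous rho g z Hg).
  destruct Hf as [f' Hf], Hg as [g' Hg].
  exists (fun z => f' z * g z + f z * g' z)%C. intros z Hz.
  destruct (Hf z Hz), (Hg z Hz). split; [now apply is_C_derive_mult|].
  apply (C_continuous_plus (T := C_Uniform)); apply (C_continuous_mult (T := C_Uniform)); auto.
Qed.

Lemma holomorphic_pow (rho : R) (n : nat) : holomorphic rho (fun z => z ^ n)%C.
Proof.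
  induction n as [|n IH]; [exact (holomorphic_const rho (RtoC 1))|].
  exact (holomorphic_mult rho _ _ (holomorphic_id rho) IH).
Qed.

Lemma holomorphic_inv (rho : R) (f : C -> C) : (forall z, Cmod z < rho -> f z <> 0) ->
  holomorphic rho f -> holomorphic rho (fun z => / f z)%C.
Proof.
  intros Hn Hf. assert (Cf := fun z => holomorphic_continuous rho f z Hf).
  destruct Hf as [f' Hf]. exists (fun z => f' z * - / (f z * f z))%C. intros z Hz.
  destruct (Hf z Hz) as [Df Cf']. split; [now apply is_C_derive_inv; auto|].
  apply (C_continuous_mult (T := C_Uniform)); [exact Cf'|].
  apply (continuous_opp (U := C_Uniform) (V := AbsRing_NormedModule C_AbsRing)).
  apply (C_continuous_inv (T := C_Uniform)); [apply Cmult_neq_0; auto|].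
  apply (C_continuous_mult (T := C_Uniform)); auto.
Qed.

Lemma holomorphic_translate (rho s : R) (f : C -> C) (a : C) : Cmod a + s <= rho ->
  holomorphic rho f -> holomorphic s (fun z => f (a + z))%C.
Proof.
  intros Ha [f' Hf]. exists (fun z => f' (a + z))%C. intros z Hz.
  destruct (Hf (a + z)%C) as [Df Cf].
  { eapply Rle_lt_trans; [apply Cmod_triangle|]. lra. }
  assert (Dt : is_C_derive (fun w => a + w)%C z (RtoC 1)).
  { replace (RtoC 1) with (0 + 1)%C by ring.
    apply (is_derive_plus (K := C_AbsRing) (V := AbsRing_NormedModule C_AbsRing)
      (fun _ => a) (fun w => w)).
    - apply (is_derive_const (K := C_AbsRing) (V := AbsRing_NormedModule C_AbsRing)).
    - apply (is_derive_id (K := C_AbsRing)). }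
  split.
  - rewrite <- (Cmult_1_l (f' (a + z)%C)).
    exact (is_derive_comp (K := C_AbsRing) (V := AbsRing_NormedModule C_AbsRing) f _ z _ _ Df Dt).
  - apply (continuous_comp (U := C_Uniform) (V := C_Uniform) (W := C_Uniform)
      (fun w => a + w)%C f').
    + exact (is_C_derive_continuous _ z 1 Dt).
    + exact Cf.
Qed.

Lemma is_C_derive_ps (rho : R) (a : nat -> C) (z : C) : convergent_on_disk rho a ->
  Cmod z < rho -> is_C_derive (ps a) z (ps (deriv_seq a) z).
Proof.
  intros Ha Hz. assert (P := Cmod_ge_0 z).
  destruct (diff_quotient_lipschitz rho a Ha ((Cmod z + rho) / 2)) as (L & HL & H); [lra|].
  apply (is_C_derive_of_quadratic _ z _ L ((rho - Cmod z) / 2)); [exact HL|lra|].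
  intros w Hw.
  assert (W : Cmod w <= (Cmod z + rho) / 2).
  { generalize (Cmod_triangle z (w - z)). replace (z + (w - z))%C with w by ring. lra. }
  rewrite <- (diff_quotient_spec rho a Ha w z), <- diff_quotient_diag by lra.
  replace ((w - z) * diff_quotient a w z - (w - z) * diff_quotient a z z)%C
    with ((w - z) * (diff_quotient a w z - diff_quotient a z z))%C by ring.
  rewrite Cmod_mult.
  replace (L * Cmod (w - z) ^ 2) with (Cmod (w - z) * (L * Cmod (w - z))) by ring.
  apply Rmult_le_compat_l; [apply Cmod_ge_0|]. apply H; lra.
Qed.

Lemma holomorphic_ps (rho : R) (a : nat -> C) :
  convergent_on_disk rho a -> holomorphic rho (ps a).
Proof.
  intros Ha. exists (ps (deriv_seq a)). intros z Hz. split; [now apply is_C_derive_ps with rho|].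
  apply is_C_derive_continuous with (ps (deriv_seq (deriv_seq a)) z).
  apply is_C_derive_ps with rho; auto. now apply convergent_on_disk_deriv.
Qed.

(** * Derivatives along curves *)

Definition is_curve_derive (gamma : R -> C) (t : R) (d : C) : Prop :=
  is_derive (fun s => Re (gamma s)) t (Re d) /\ is_derive (fun s => Im (gamma s)) t (Im d).

Lemma is_C_derive_differentiable (f : C -> C) (z l : C) : is_C_derive f z l ->
  differentiable_pt_lim (fun x y => Re (f (x, y))) (Re z) (Im z) (Re l) (- Im l) /\
  differentiable_pt_lim (fun x y => Im (f (x, y))) (Re z) (Im z) (Im l) (Re l).
Proof.
  intros H.
  assert (B : forall eps : posreal, locally_2d (fun x y =>
    Cmod (f (x, y) - f z - ((x, y) - z) * l) <= eps * Rmax (Rabs (x - Re z)) (Rabs (y - Im z)))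
    (Re z) (Im z)).
  { intros eps. assert (He : 0 < eps / 2) by (generalize (cond_pos eps); lra).
    destruct (proj1 (is_C_derive_iff f z l) H (mkposreal _ He)) as [d Hd].
    assert (Hd2 : 0 < d / 2) by (generalize (cond_pos d); lra).
    exists (mkposreal _ Hd2). intros x y Hx Hy. simpl in Hx, Hy.
    assert (M : Cmod ((x, y) - z) <= Rabs (x - Re z) + Rabs (y - Im z))
      by exact (Cmod_le_Re_Im ((x, y) - z)%C).
    eapply Rle_trans; [apply Hd; change (Cmod ((x, y) - z) < d); lra|]. simpl pos.
    assert (M1 := Rmax_l (Rabs (x - Re z)) (Rabs (y - Im z))).
    assert (M2 := Rmax_r (Rabs (x - Re z)) (Rabs (y - Im z))).
    apply Rle_trans with (eps / 2 * (2 * Rmax (Rabs (x - Re z)) (Rabs (y - Im z)))); [|lra].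
    apply Rmult_le_compat_l; lra. }
  split; intros eps; destruct (B eps) as [d Hd]; exists d; intros x y Hx Hy;
    (eapply Rle_trans; [|exact (Hd x y Hx Hy)]).
  - eapply Rle_trans; [|apply re_le_Cmod]. right. f_equal.
    destruct z as [z1 z2], l as [l1 l2]. unfold Re, Im. simpl. ring.
  - eapply Rle_trans; [|apply Rabs_Im_le_Cmod]. right. f_equal.
    destruct z as [z1 z2], l as [l1 l2]. unfold Re, Im. simpl. ring.
Qed.

Lemma is_curve_derive_comp (f : C -> C) (gamma : R -> C) (t : R) (l d : C) :
  is_C_derive f (gamma t) l -> is_curve_derive gamma t d ->
  is_curve_derive (fun s => f (gamma s)) t (l * d)%C.
Proof.
  intros Hf [DRe DIm]. destruct (is_C_derive_differentiable f (gamma t) l Hf) as [D1 D2].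
  apply is_derive_Reals in DRe, DIm. split; apply is_derive_Reals.
  - apply (derivable_pt_lim_ext (fun s => Re (f (Re (gamma s), Im (gamma s)))));
      [intros s; now rewrite C_eta|].
    replace (Re (l * d)) with (Re l * Re d + - Im l * Im d) by (unfold Re, Im; simpl; ring).
    exact (derivable_pt_lim_comp_2d _ _ _ t _ _ _ _ D1 DRe DIm).
  - apply (derivable_pt_lim_ext (fun s => Im (f (Re (gamma s), Im (gamma s)))));
      [intros s; now rewrite C_eta|].
    replace (Im (l * d)) with (Im l * Re d + Re l * Im d) by (unfold Re, Im; simpl; ring).
    exact (derivable_pt_lim_comp_2d _ _ _ t _ _ _ _ D2 DRe DIm).
Qed.

(* [u] is locally the real part of a primitive of [q]. *)
Definition has_gradient (rho : R) (u : C -> R) (q : C -> C) : Prop :=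
  forall (gamma : R -> C) (t : R) (d : C), is_curve_derive gamma t d ->
    Cmod (gamma t) < rho -> is_derive (fun s => u (gamma s)) t (Re (q (gamma t) * d)).

Lemma has_gradient_Re (rho : R) (f f' : C -> C) :
  (forall z, Cmod z < rho -> is_C_derive f z (f' z)) ->
  has_gradient rho (fun z => Re (f z)) f'.
Proof.
  intros H gamma t d Hd Ht. now apply (is_curve_derive_comp f gamma t (f' (gamma t)) d); auto.
Qed.

Lemma has_gradient_ln_Cmod (rho : R) (f f' : C -> C) :
  (forall z, Cmod z < rho -> f z <> 0) ->
  (forall z, Cmod z < rho -> is_C_derive f z (f' z)) ->
  has_gradient rho (fun z => ln (Cmod (f z))) (fun z => f' z / f z)%C.
Proof.
  intros Hn H gamma t d Hd Ht.
  destruct (is_curve_derive_comp f gamma t (f' (gamma t)) d) as [D1 D2]; auto.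
  specialize (Hn _ Ht). set (l := (f' (gamma t) * d)%C) in *.
  assert (S : 0 < Re (f (gamma t)) ^ 2 + Im (f (gamma t)) ^ 2).
  { rewrite <- Cmod2_alt. apply pow_lt. now apply Cmod_gt_0. }
  replace (f' (gamma t) / f (gamma t) * d)%C with (l / f (gamma t))%C by (unfold l; field; auto).
  assert (D := is_derive_plus (V := R_NormedModule) _ _ t _ _
    (is_derive_pow _ 2 t _ D1) (is_derive_pow _ 2 t _ D2)).
  assert (G : is_derive (fun p => ln (sqrt p)) (Re (f (gamma t)) ^ 2 + Im (f (gamma t)) ^ 2)
    (/ (2 * (Re (f (gamma t)) ^ 2 + Im (f (gamma t)) ^ 2)))).
  { assert (Q := sqrt_lt_R0 _ S). auto_derive; [auto|].
    rewrite <- (sqrt_sqrt _ (Rlt_le _ _ S)) at 3. field. lra. }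
  apply (is_derive_comp (fun p => ln (sqrt p)) _ t _ _ G) in D.
  replace (Re (l / f (gamma t))) with
    ((INR 2 * Re l * Re (f (gamma t)) ^ 1 + INR 2 * Im l * Im (f (gamma t)) ^ 1)
      * / (2 * (Re (f (gamma t)) ^ 2 + Im (f (gamma t)) ^ 2))); [exact D|].
  unfold Re, Im in *. simpl in *. field. lra.
Qed.

(** * Integrals depending on a parameter *)

Lemma ex_RInt_everywhere_continuous (f : R -> R) (a b : R) :
  (forall x, continuous f x) -> ex_RInt f a b.
Proof. intros H. apply (ex_RInt_continuous (V := R_CompleteNormedModule)). intros; apply H. Qed.

Lemma continuity_2d_pt_section_r (f : R -> R -> R) (x y : R) :
  continuity_2d_pt f x y -> continuous (f x) y.
Proof.
  intros H. apply continuity_pt_filterlim, continuity_pt_locally.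
  intros eps. destruct (H eps) as [d Hd]. exists d. intros v Hv.
  apply Hd; [|exact Hv]. rewrite Rminus_diag, Rabs_R0. apply cond_pos.
Qed.

Lemma continuity_2d_pt_swap (f : R -> R -> R) (x y : R) :
  continuity_2d_pt f x y -> continuity_2d_pt (fun u v => f v u) y x.
Proof. intros H eps. destruct (H eps) as [d Hd]. exists d. intros u v Hu Hv. now apply Hd. Qed.

Lemma continuous_RInt_param (f : R -> R -> R) (c d x : R) :
  (forall t u, continuity_2d_pt f t u) -> continuous (fun t => RInt (f t) c d) x.
Proof.
  intros H. apply continuity_pt_filterlim, continuity_pt_locally. intros eps.
  assert (Hp := cond_pos eps). assert (P := Rabs_pos (d - c)).
  assert (He : 0 < eps / (Rabs (d - c) + 1)) by (apply Rdiv_lt_0_compat; lra).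
  destruct (uniform_continuity_2d_1d' f (Rmin c d) (Rmax c d) x (fun t _ => H x t)
    (mkposreal _ He)) as [del Hdel].
  exists del. intros t Ht. change (Rabs (t - x) < del) in Ht.
  assert (E : forall t, ex_RInt (f t) c d).
  { intros s. apply ex_RInt_everywhere_continuous. intros u. apply continuity_2d_pt_section_r, H. }
  apply Rle_lt_trans with (Rabs (d - c) * (eps / (Rabs (d - c) + 1))).
  - apply (norm_RInt_le_const_abs (V := R_NormedModule) (fun u => minus (f t u) (f x u)) c d).
    + intros u Hu. apply Rlt_le. apply Rabs_def2 in Ht. assert (Hd := cond_pos del).
      apply (Hdel u x u t); try lra. rewrite Rminus_diag, Rabs_R0. exact Hd.
    + apply (is_RInt_minus (V := R_NormedModule));
        apply (RInt_correct (V := R_CompleteNormedModule)), E.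
  - apply Rmult_lt_reg_r with (Rabs (d - c) + 1); [lra|].
    replace (Rabs (d - c) * (eps / (Rabs (d - c) + 1)) * (Rabs (d - c) + 1))
      with (Rabs (d - c) * eps) by (field; lra).
    nra.
Qed.

Lemma is_derive_RInt_param_everywhere (f df : R -> R -> R) (a b x : R) :
  locally x (fun y => forall t, is_derive (fun u => f u t) y (df y t)) ->
  (forall t, continuity_2d_pt df x t) ->
  locally x (fun y => forall t, continuous (f y) t) ->
  is_derive (fun y => RInt (f y) a b) x (RInt (df x) a b).
Proof.
  intros D Cdf Cf.
  assert (Dx := locally_singleton _ _ D). simpl in Dx.
  rewrite <- (RInt_ext (fun t => Derive (fun u => f u t) x) (df x));
    [|intros t _; now apply is_derive_unique].
  apply is_derive_RInt_param.
  - revert D. apply filter_imp. intros y Hy t _. now exists (df y t).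
  - intros t _. apply (continuity_2d_pt_ext_loc df); [|apply Cdf].
    destruct D as [d Hd]. exists d. intros u v Hu _. symmetry. apply is_derive_unique.
    now apply (Hd u Hu).
  - revert Cf. apply filter_imp. intros y Hy. now apply ex_RInt_everywhere_continuous.
Qed.

Lemma is_derive_RInt_upper (f : R -> R) (a x : R) :
  (forall y, continuous f y) -> is_derive (RInt f a) x (f x).
Proof.
  intros H. apply (is_derive_RInt f (RInt f a) a x); [|apply H].
  apply filter_forall. intros t. apply (RInt_correct (V := R_CompleteNormedModule)).
  now apply ex_RInt_everywhere_continuous.
Qed.

Lemma eq_of_is_derive_0 (f : R -> R) (a b : R) : a <= b ->
  (forall x, a <= x <= b -> continuous f x) -> (forall x, a < x < b -> is_derive f x 0) ->
  f b = f a.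
Proof.
  intros Hab Cf D. destruct (MVT_gen f a b (fun _ => 0)) as [c [_ E]].
  - rewrite Rmin_left, Rmax_right by lra. exact D.
  - rewrite Rmin_left, Rmax_right by lra. intros x Hx.
    now apply continuity_pt_filterlim, Cf.
  - lra.
Qed.

Lemma RInt_swap (f : R -> R -> R) (a b c d : R) : a <= b ->
  (forall x y, continuity_2d_pt f x y) ->
  RInt (fun x => RInt (f x) c d) a b = RInt (fun y => RInt (fun x => f x y) a b) c d.
Proof.
  intros Hab H.
  assert (Hs : forall x y, continuity_2d_pt (fun y x => f x y) y x)
    by (intros x y; apply continuity_2d_pt_swap, H).
  set (g := fun t =>
    RInt (fun x => RInt (f x) c d) a t - RInt (fun y => RInt (fun x => f x y) a t) c d).
  assert (D : forall t, is_derive g t 0).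
  { intros t. rewrite <- (Rminus_diag (RInt (f t) c d)).
    apply (is_derive_minus (V := R_NormedModule)).
    - apply (is_derive_RInt_upper (fun x => RInt (f x) c d)). intros y.
      now apply continuous_RInt_param.
    - apply (is_derive_RInt_param_everywhere (fun t y => RInt (fun x => f x y) a t) f); auto;
        apply filter_forall; intros s u.
      + apply (is_derive_RInt_upper (fun x => f x u)). intros x.
        apply (continuity_2d_pt_section_r (fun y x => f x y)), Hs.
      + now apply (continuous_RInt_param (fun y x => f x y)). }
  apply Rminus_diag_uniq. change (g b = 0). transitivity (g a).
  - apply eq_of_is_derive_0; auto. intros x _.
    apply (ex_derive_continuous (V := R_NormedModule)). now exists 0.
  - unfold g. rewrite RInt_point, (RInt_ext _ (fun _ => 0)).
    + rewrite RInt_const. unfold zero, scal; simpl; unfold mult; simpl. ring.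
    + intros y _. apply (RInt_point (V := R_CompleteNormedModule)).
Qed.

Lemma RInt_periodic_shift (f : R -> R) (T s : R) : (forall x, continuous f x) ->
  (forall x, f (x + T) = f x) -> RInt (fun x => f (x + s)) 0 T = RInt f 0 T.
Proof.
  intros Cf P.
  assert (E : forall a b, ex_RInt f a b) by (intros; now apply ex_RInt_everywhere_continuous).
  assert (Sh : forall u a b, RInt (fun x => f (x + u)) a b = RInt f (a + u) (b + u)).
  { intros u a b. assert (L := RInt_comp_lin (V := R_CompleteNormedModule) f 1 u a b (E _ _)).
    rewrite !Rmult_1_l in L. rewrite <- L. apply RInt_ext. intros x _.
    change (f (x + u) = 1 * f (1 * x + u)). now rewrite !Rmult_1_l. }
  assert (J : RInt f T (T + s) = RInt f 0 s).
  { rewrite <- (Rplus_0_l T) at 1. rewrite (Rplus_comm T s), <- Sh.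
    apply RInt_ext. intros x _. apply P. }
  rewrite Sh, Rplus_0_l.
  assert (C1 := RInt_Chasles (V := R_CompleteNormedModule) f 0 s (T + s) (E _ _) (E _ _)).
  assert (C2 := RInt_Chasles (V := R_CompleteNormedModule) f 0 T (T + s) (E _ _) (E _ _)).
  rewrite <- C1, J in C2. unfold plus in C2; simpl in C2. lra.
Qed.

(** * The unit circle *)

Definition cis (t : R) : C := (cos t, sin t).

Lemma cis_plus (s t : R) : cis (s + t) = (cis s * cis t)%C.
Proof. unfold cis, Cmult; simpl. rewrite cos_plus, sin_plus. f_equal; ring. Qed.

Lemma cis_0 : cis 0 = 1.
Proof. unfold cis. now rewrite cos_0, sin_0. Qed.

Lemma cis_2PI : cis (2 * PI) = 1.
Proof. unfold cis. now rewrite cos_2PI, sin_2PI. Qed.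

Lemma cis_mult_conj (t : R) : (cis t * Cconj (cis t) = 1)%C.
Proof.
  unfold cis, Cconj, Cmult, RtoC; simpl. generalize (sin2_cos2 t). unfold Rsqr. intros E.
  f_equal; [lra|ring].
Qed.

Lemma Cmod_cis (t : R) : Cmod (cis t) = 1.
Proof.
  apply Rsqr_inj; [apply Cmod_ge_0|lra|].
  assert (E := Cmod2_conj (cis t)). rewrite cis_mult_conj in E. injection E as E.
  unfold Rsqr. lra.
Qed.

Lemma cis_neq_1 (theta : R) : 0 < theta < PI -> cis theta <> 1.
Proof. intros H E. injection E as _ E. generalize (sin_gt_0 theta). lra. Qed.

Lemma Cmod_circle (r t : R) : 0 <= r -> Cmod (r * cis t) = r.
Proof. intros Hr. rewrite Cmod_mult, Cmod_R, Cmod_cis, Rabs_pos_eq; lra. Qed.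

Lemma is_curve_derive_circle (r t : R) :
  is_curve_derive (fun s => r * cis s)%C t (Ci * (r * cis t)).
Proof. split; simpl; auto_derive; auto; ring. Qed.

Lemma is_curve_derive_ray (r t : R) : is_curve_derive (fun s => s * cis t)%C r (cis t).
Proof. split; simpl; auto_derive; auto; ring. Qed.

Lemma cis_pow (n : nat) (t : R) : (cis t ^ n)%C = cis (INR n * t).
Proof.
  induction n as [|n IH]; [simpl; now rewrite Rmult_0_l, cis_0|].
  rewrite S_INR, Rmult_plus_distr_r, Rmult_1_l, cis_plus, <- IH. simpl. ring.
Qed.

Lemma is_curve_derive_cis_pow (c : C) (n : nat) (t : R) :
  is_curve_derive (fun s => c * cis s ^ n)%C t (Ci * INR n * (c * cis t ^ n)).
Proof.
  rewrite cis_pow. split;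
    (eapply is_derive_ext; [intros s; rewrite cis_pow; reflexivity|]);
    unfold Re, Im; simpl; auto_derive; auto; ring.
Qed.

Lemma C_continuous_pair {T : UniformSpace} (f g : T -> R) (x : T) :
  continuous f x -> continuous g x -> C_continuous (fun y => (f y, g y) : C) x.
Proof.
  intros Hf Hg. apply filterlim_locally. intros eps.
  assert (He : 0 < eps / 2) by (generalize (cond_pos eps); lra).
  assert (Ef := proj1 (filterlim_locally _ _) Hf (mkposreal _ He)).
  assert (Eg := proj1 (filterlim_locally _ _) Hg (mkposreal _ He)).
  generalize (filter_and _ _ Ef Eg). apply filter_imp. intros y [Nf Ng].
  change (Rabs (f y - f x) < eps / 2) in Nf. change (Rabs (g y - g x) < eps / 2) in Ng.
  change (Cmod ((f y, g y) - (f x, g x)) < eps).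
  eapply Rle_lt_trans; [apply Cmod_le_Re_Im|].
  change (Rabs (f y - f x) + Rabs (g y - g x) < eps). lra.
Qed.

Lemma continuous_Re {T : UniformSpace} (f : T -> C) (x : T) :
  C_continuous f x -> continuous (fun y => Re (f y)) x.
Proof.
  intros H. apply filterlim_locally. intros eps.
  generalize (proj1 (filterlim_locally _ _) H eps). apply filter_imp. intros y Hy.
  eapply Rle_lt_trans; [apply (re_le_Cmod (f y - f x)%C)|exact Hy].
Qed.

Lemma continuous_Im {T : UniformSpace} (f : T -> C) (x : T) :
  C_continuous f x -> continuous (fun y => Im (f y)) x.
Proof.
  intros H. apply filterlim_locally. intros eps.
  generalize (proj1 (filterlim_locally _ _) H eps). apply filter_imp. intros y Hy.
  eapply Rle_lt_trans; [apply (Rabs_Im_le_Cmod (f y - f x)%C)|exact Hy].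
Qed.

Lemma C_continuous_conj {T : UniformSpace} (f : T -> C) (x : T) :
  C_continuous f x -> C_continuous (fun y => Cconj (f y)) x.
Proof.
  intros H. apply C_continuous_pair; [now apply continuous_Re|].
  apply (continuous_opp (V := R_NormedModule)). now apply continuous_Im.
Qed.

Lemma C_continuous_pow {T : UniformSpace} (f : T -> C) (n : nat) (x : T) :
  C_continuous f x -> C_continuous (fun y => f y ^ n)%C x.
Proof.
  intros H. induction n as [|n IH]; [exact (C_continuous_const (RtoC 1) x)|].
  now apply C_continuous_mult.
Qed.

Lemma continuous_Cmod {T : UniformSpace} (f : T -> C) (x : T) :
  C_continuous f x -> continuous (fun y => Cmod (f y)) x.
Proof.
  intros H. apply filterlim_locally. intros eps.
  generalize (proj1 (filterlim_locally _ _) H eps). apply filter_imp. intros y Hy.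
  eapply Rle_lt_trans; [|exact Hy].
  change (Rabs (Cmod (f y) - Cmod (f x)) <= Cmod (f y - f x)).
  assert (T1 := Cmod_triangle (f y - f x) (f x)). assert (T2 := Cmod_triangle (f x - f y) (f y)).
  rewrite Cmod_minus_sym in T2.
  replace (f y - f x + f x)%C with (f y) in T1 by ring.
  replace (f x - f y + f y)%C with (f x) in T2 by ring.
  apply Rabs_le. lra.
Qed.

Lemma C_continuous_cis {T : UniformSpace} (f : T -> R) (x : T) :
  continuous f x -> C_continuous (fun y => cis (f y)) x.
Proof.
  intros H. apply C_continuous_pair.
  - now apply (continuous_comp f cos); [|apply continuous_cos].
  - now apply (continuous_comp f sin); [|apply continuous_sin].
Qed.

Lemma cis_continuous (t : R) : C_continuous cis t.
Proof. exact (C_continuous_cis (fun t => t) t (continuous_id t)). Qed.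

Lemma C_continuous_RtoC {T : UniformSpace} (f : T -> R) (x : T) :
  continuous f x -> C_continuous (fun y => RtoC (f y)) x.
Proof. intros H. apply C_continuous_pair; [exact H|apply continuous_const]. Qed.

Lemma continuous_pow {T : UniformSpace} (f : T -> R) (n : nat) (x : T) :
  continuous f x -> continuous (fun y => f y ^ n) x.
Proof.
  intros H. induction n as [|n IH]; [apply continuous_const|].
  now apply (continuous_mult (K := R_AbsRing)).
Qed.

Lemma continuous_inv {T : UniformSpace} (f : T -> R) (x : T) :
  f x <> 0 -> continuous f x -> continuous (fun y => / f y) x.
Proof. intros Hx Hf. apply (continuous_comp f Rinv); [exact Hf|now apply continuous_Rinv]. Qed.

Lemma continuous_ln_comp {T : UniformSpace} (f : T -> R) (x : T) :
  0 < f x -> continuous f x -> continuous (fun y => ln (f y)) x.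
Proof. intros Hx Hf. apply (continuous_comp f ln); [exact Hf|now apply continuous_ln]. Qed.

Lemma continuous_comp_fst {U V W : UniformSpace} (f : U -> W) (p : U * V) :
  (forall x, continuous f x) -> continuous (fun p : U * V => f (fst p)) p.
Proof. intros H. apply (continuous_comp fst f); [apply continuous_fst|apply H]. Qed.

Lemma continuous_comp_snd {U V W : UniformSpace} (f : V -> W) (p : U * V) :
  (forall y, continuous f y) -> continuous (fun p : U * V => f (snd p)) p.
Proof. intros H. apply (continuous_comp snd f); [apply continuous_snd|apply H]. Qed.

Ltac solve_continuous :=
  lazymatch goal with
  | H : continuous ?f ?x |- continuous ?f ?x => exact H
  | |- @continuous ?T _ (fun x => Cplus (@?f x) (@?g x)) _ => apply (C_continuous_plus (T := T) f g)
  | |- @continuous ?T _ (fun x => Cminus (@?f x) (@?g x)) _ =>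
      apply (C_continuous_minus (T := T) f g)
  | |- @continuous ?T _ (fun x => Cmult (@?f x) (@?g x)) _ => apply (C_continuous_mult (T := T) f g)
  | |- @continuous ?T _ (fun x => Cpow (@?f x) ?n) _ => apply (C_continuous_pow (T := T) f n)
  | |- @continuous ?T _ (fun x => Cconj (@?f x)) _ => apply (C_continuous_conj (T := T) f)
  | |- @continuous ?T _ (fun x => cis (@?f x)) _ => apply (C_continuous_cis (T := T) f)
  | |- continuous cis _ => apply cis_continuous
  | |- @continuous ?T _ (fun x => RtoC (@?f x)) _ => apply (C_continuous_RtoC (T := T) f)
  | |- @continuous ?T _ (fun x => Re (@?f x)) _ => apply (continuous_Re (T := T) f)
  | |- @continuous ?T _ (fun x => Im (@?f x)) _ => apply (continuous_Im (T := T) f)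
  | |- @continuous ?T _ (fun x => Rplus (@?f x) (@?g x)) _ =>
      apply (continuous_plus (V := R_NormedModule) f g)
  | |- @continuous ?T _ (fun x => Rminus (@?f x) (@?g x)) _ =>
      apply (continuous_minus (V := R_NormedModule) f g)
  | |- @continuous ?T _ (fun x => Ropp (@?f x)) _ => apply (continuous_opp (V := R_NormedModule) f)
  | |- @continuous ?T _ (fun x => Rmult (@?f x) (@?g x)) _ =>
      apply (continuous_mult (K := R_AbsRing) f g)
  | |- @continuous ?T _ (fun x => pow (@?f x) ?n) _ => apply (continuous_pow (T := T) f n)
  | |- @continuous ?T _ (fun x => Cmod (@?f x)) _ => apply (continuous_Cmod (T := T) f)
  | |- @continuous ?T _ (fun x => x) ?y => exact (@continuous_id T y)
  | |- @continuous ?T _ (fun x => fst x) _ => apply continuous_fst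
  | |- @continuous ?T _ (fun x => snd x) _ => apply continuous_snd
  | |- @continuous ?T _ (fun x => ?f (fst x)) _ =>
      first [apply (continuous_comp_fst (W := C_Uniform) f) | apply (continuous_comp_fst f)]
  | |- @continuous ?T _ (fun x => ?f (snd x)) _ =>
      first [apply (continuous_comp_snd (W := C_Uniform) f) | apply (continuous_comp_snd f)]
  | |- @continuous ?T ?U (fun _ => ?c) ?y => exact (@continuous_const T U c y)
  | |- _ => solve [auto]
  end; try solve_continuous.

Lemma C_continuous_circle (p : R * R) : C_continuous (fun p : R * R => fst p * cis (snd p))%C p.
Proof. solve_continuous. Qed.

Lemma Re_scal (x : R) (z : C) : Re (x * z) = x * Re z.
Proof. unfold Re. simpl. ring. Qed.

Lemma Re_plus (z w : C) : Re (z + w) = Re z + Re w.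
Proof. reflexivity. Qed.

Definition angle_integral (f : R -> R) : R := RInt f 0 (2 * PI).

Lemma angle_integral_ext (f g : R -> R) :
  (forall t, f t = g t) -> angle_integral f = angle_integral g.
Proof. intros H. apply (RInt_ext (V := R_CompleteNormedModule)). intros t _. apply H. Qed.

Lemma angle_integral_const (c : R) : angle_integral (fun _ => c) = 2 * PI * c.
Proof.
  transitivity ((2 * PI - 0) * c); [|ring].
  exact (RInt_const (V := R_CompleteNormedModule) 0 (2 * PI) c).
Qed.

Lemma angle_integral_scal (f : R -> R) (c : R) : (forall t, continuous f t) ->
  angle_integral (fun t => c * f t) = c * angle_integral f.
Proof.
  intros H. apply (RInt_scal (V := R_CompleteNormedModule) f 0 (2 * PI) c).
  now apply ex_RInt_everywhere_continuous.
Qed.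

Lemma angle_integral_plus (f g : R -> R) :
  (forall t, continuous f t) -> (forall t, continuous g t) ->
  angle_integral (fun t => f t + g t) = angle_integral f + angle_integral g.
Proof.
  intros Hf Hg.
  apply (RInt_plus (V := R_CompleteNormedModule) f g); now apply ex_RInt_everywhere_continuous.
Qed.

Lemma angle_integral_le (f g : R -> R) :
  (forall t, continuous f t) -> (forall t, continuous g t) -> (forall t, f t <= g t) ->
  angle_integral f <= angle_integral g.
Proof.
  intros Hf Hg H. apply RInt_le; auto using ex_RInt_everywhere_continuous.
  generalize PI_RGT_0. lra.
Qed.

Lemma angle_integral_derive (f df : R -> R) : (forall t, is_derive f t (df t)) ->
  (forall t, continuous df t) -> f (2 * PI) = f 0 -> angle_integral df = 0.
Proof.
  intros D Cdf P. transitivity (f (2 * PI) - f 0); [|rewrite P; ring]. apply is_RInt_unique.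
  apply (is_RInt_derive (V := R_CompleteNormedModule) f df); auto.
Qed.

Section circle_mean.
Variables (rho : R) (u : C -> R) (q : C -> C).
Hypothesis Hu : has_gradient rho u q.
Hypothesis Cq : forall z, Cmod z < rho -> CC_continuous q z.

Lemma C_continuous_on_circle (r t : R) : 0 <= r < rho -> C_continuous (fun s => q (r * cis s)%C) t.
Proof.
  intros Hr. apply (continuous_comp (V := C_Uniform) (W := C_Uniform) (fun s => r * cis s)%C q).
  - apply C_continuous_mult; [apply C_continuous_const|]. apply C_continuous_cis, continuous_id.
  - apply Cq. rewrite Cmod_circle; lra.
Qed.

Lemma continuous_on_circle (r t : R) : 0 <= r < rho -> continuous (fun s => u (r * cis s)%C) t.
Proof.
  intros Hr. apply (ex_derive_continuous (V := R_NormedModule)). eexists.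
  apply (Hu (fun s => r * cis s)%C); [apply is_curve_derive_circle|].
  rewrite Cmod_circle; lra.
Qed.

Lemma is_derive_circle_integral (r : R) : Rabs r < rho ->
  is_derive (fun s : R => angle_integral (fun t => u (s * cis t)%C)) r
    (angle_integral (fun t => Re (q (r * cis t) * cis t))).
Proof.
  intros Hr.
  assert (Near : locally r (fun s => Rabs s < rho)).
  { apply (continuous_Rabs r (fun y => y < rho)). now apply open_lt. }
  assert (M : forall s t, Rabs s < rho -> Cmod (s * cis t) < rho).
  { intros s t Hs. now rewrite Cmod_mult, Cmod_R, Cmod_cis, Rmult_1_r. }
  apply (is_derive_RInt_param_everywhere (fun s t => u (s * cis t)%C)
    (fun s t => Re (q (s * cis t) * cis t))).
  - revert Near. apply filter_imp. intros s Hs t.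
    apply (Hu (fun s => s * cis t)%C); [apply is_curve_derive_ray|now apply M].
  - intros t. apply continuity_2d_pt_filterlim.
    apply (continuous_Re (fun p : R * R => q (fst p * cis (snd p)) * cis (snd p))%C (r, t)).
    apply C_continuous_mult; [|apply C_continuous_cis, continuous_snd].
    apply (continuous_comp (V := C_Uniform) (W := C_Uniform)
      (fun p : R * R => fst p * cis (snd p))%C q); [apply C_continuous_circle|].
    now apply Cq, M.
  - revert Near. apply filter_imp. intros s Hs t.
    apply (ex_derive_continuous (V := R_NormedModule)). eexists.
    apply (Hu (fun t => s * cis t)%C); [apply is_curve_derive_circle|now apply M].
Qed.

Lemma circle_mean_of_flux (r : R) : 0 <= r < rho ->
  (forall s, 0 < s < rho -> angle_integral (fun t => Re (q (s * cis t) * (s * cis t))) = 0) ->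
  angle_integral (fun t => u (r * cis t)%C) = 2 * PI * u 0.
Proof.
  intros Hr Flux.
  transitivity (angle_integral (fun t => u (0 * cis t)%C)).
  - apply (eq_of_is_derive_0 (fun s : R => angle_integral (fun t => u (s * cis t)%C))); [lra| |].
    + intros s Hs. apply (ex_derive_continuous (V := R_NormedModule)). eexists.
      apply is_derive_circle_integral. rewrite Rabs_pos_eq; lra.
    + intros s Hs. assert (D := is_derive_circle_integral s ltac:(rewrite Rabs_pos_eq; lra)).
      replace (angle_integral (fun t => Re (q (s * cis t) * cis t))) with 0 in D; [exact D|].
      apply Rmult_eq_reg_l with s; [|lra]. rewrite Rmult_0_r, <- angle_integral_scal.
      * symmetry. etransitivity; [|apply (Flux s); lra]. apply angle_integral_ext.
        intros t. rewrite <- Re_scal. f_equal. ring.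
      * intros t. apply continuous_Re, C_continuous_mult.
        { apply C_continuous_on_circle. lra. }
        apply C_continuous_cis, continuous_id.
  - rewrite <- angle_integral_const. apply angle_integral_ext. intros t. now rewrite Cmult_0_l.
Qed.

End circle_mean.

(* On a circle, [z f'(z)] is [- i] times the derivative of [f] in the angle. *)
Theorem circle_mean_holomorphic (rho r : R) (f : C -> C) : holomorphic rho f -> 0 <= r < rho ->
  angle_integral (fun t => Re (f (r * cis t)%C)) = 2 * PI * Re (f 0).
Proof.
  intros [f' H] Hr.
  assert (Cf' : forall z, Cmod z < rho -> CC_continuous f' z) by (intros; now apply H).
  apply (circle_mean_of_flux rho (fun z => Re (f z)) f'); auto.
  - apply has_gradient_Re. intros; now apply H.
  - intros s Hs. apply (angle_integral_derive (fun t => Im (f (s * cis t)%C))).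
    + intros t.
      destruct (is_curve_derive_comp f (fun t => s * cis t)%C t (f' (s * cis t)%C)
        (Ci * (s * cis t))) as [_ D].
      * apply H. rewrite Cmod_circle; lra.
      * apply is_curve_derive_circle.
      * replace (Re (f' (s * cis t)%C * (s * cis t)))
        with (Im (f' (s * cis t)%C * (Ci * (s * cis t))));
          [exact D|].
        unfold Re, Im. simpl. ring.
    + intros t. apply continuous_Re, C_continuous_mult.
      * apply (C_continuous_on_circle rho f'); auto. lra.
      * apply C_continuous_mult; [apply C_continuous_const|]. apply C_continuous_cis, continuous_id.
    + now rewrite cis_2PI, cis_0.
Qed.

Section harmonic.
Variables (rho : R) (u : C -> R) (q : C -> C).
Hypothesis Hu : has_gradient rho u q.
Hypothesis Hq : holomorphic rho q.

Lemma circle_mean_harmonic (r : R) : 0 <= r < rho ->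
  angle_integral (fun t => u (r * cis t)%C) = 2 * PI * u 0.
Proof.
  intros Hr. apply (circle_mean_of_flux rho u q); auto.
  - intros z. now apply holomorphic_continuous.
  - intros s Hs.
    rewrite (circle_mean_holomorphic rho s (fun z => q z * z)%C);
      [|apply holomorphic_mult; [exact Hq|apply holomorphic_id]|lra].
    rewrite Cmult_0_r. simpl. ring.
Qed.

Lemma circle_integral_mul_pow (r : R) (c : C) (n : nat) : 0 < r < rho ->
  angle_integral (fun t => Re (c * cis t ^ n * (r * cis t * q (r * cis t)))) = 0.
Proof.
  intros Hr. assert (P : 0 < r ^ n) by (apply pow_lt; lra).
  set (f := fun z => (c * z ^ n * (z * q z))%C).
  apply Rmult_eq_reg_l with (r ^ n); [|lra]. rewrite Rmult_0_r, <- angle_integral_scal.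
  - rewrite (angle_integral_ext _ (fun t => Re (f (r * cis t)%C))).
    + rewrite (circle_mean_holomorphic rho r); [unfold f; simpl; ring| |lra].
      apply holomorphic_mult; apply holomorphic_mult; auto using holomorphic_id.
      * apply holomorphic_const.
      * apply holomorphic_pow.
    + intros t. rewrite <- Re_scal. f_equal. unfold f. rewrite Cpow_mult_l, RtoC_pow. ring.
  - intros t. solve_continuous. apply (C_continuous_on_circle rho q); [|lra].
    intros z. now apply holomorphic_continuous.
Qed.

(* Integration by parts of [u] against [Im (c z^n)]; the product of imaginary parts that
   appears is half the difference of two real parts, one of which has mean zero. *)
Lemma circle_fourier_harmonic (r : R) (c : C) (n : nat) : 0 < r < rho ->
  2 * INR n * angle_integral (fun t => u (r * cis t)%C * Re (c * cis t ^ n)) =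
  angle_integral (fun t => Re (Cconj (c * cis t ^ n) * (r * cis t * q (r * cis t)))).
Proof.
  intros Hr. set (z := fun t => (r * cis t)%C). set (p := fun t => (c * cis t ^ n)%C).
  assert (Cq : forall t, C_continuous (fun t => q (z t)) t).
  { intros t. apply (C_continuous_on_circle rho q); [|lra].
    intros w. now apply holomorphic_continuous. }
  assert (Cu : forall t, continuous (fun t => u (z t)) t)
    by (intros t; apply (continuous_on_circle rho u q Hu); lra).
  assert (Cz : forall t, C_continuous z t) by (intros t; unfold z; solve_continuous).
  assert (Cp : forall t, C_continuous p t) by (intros t; unfold p; solve_continuous).
  assert (Parts : angle_integral (fun t => Re (q (z t) * (Ci * z t)) * Im (p t)
     + u (z t) * (INR n * Re (p t))) = 0).
  { apply (angle_integral_derive (fun t => u (z t) * Im (p t))).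
    - intros t. destruct (is_curve_derive_cis_pow c n t) as [_ Dp].
      assert (Du := Hu z t _ (is_curve_derive_circle r t)
        ltac:(unfold z; rewrite Cmod_circle; lra)).
      replace (INR n * Re (p t)) with (Im (Ci * INR n * (c * cis t ^ n)))
        by (unfold p, Re, Im; simpl; ring).
      exact (is_derive_mult (K := R_AbsRing) _ _ t _ _ Du Dp Rmult_comm).
    - intros t. solve_continuous.
    - unfold z, p. now rewrite cis_2PI, cis_0. }
  assert (Zero := circle_integral_mul_pow r c n Hr).
  symmetry. rewrite (angle_integral_ext _
    (fun t => Re (p t * (z t * q (z t))) + (-2 * (Re (q (z t) * (Ci * z t)) * Im (p t)
       + u (z t) * (INR n * Re (p t))) + 2 * INR n * (u (z t) * Re (p t))))).
  - rewrite !angle_integral_plus, !angle_integral_scal by (intros t; solve_continuous).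
    unfold z, p in *. rewrite Zero, Parts. ring.
  - intros t. unfold z, p, Re, Im, Cconj. simpl. ring.
Qed.

Lemma circle_fourier_harmonic_1 (r : R) (c : C) : 0 < r < rho ->
  angle_integral (fun t => u (r * cis t)%C * Re (c * cis t)) = PI * r * Re (Cconj c * q 0).
Proof.
  intros Hr. apply Rmult_eq_reg_l with (2 * INR 1); [|simpl; lra].
  rewrite (angle_integral_ext _ (fun t => u (r * cis t)%C * Re (c * cis t ^ 1)))
    by (intros t; now rewrite Cpow_1_r).
  rewrite circle_fourier_harmonic by exact Hr.
  transitivity (2 * PI * Re (r * Cconj c * q 0)).
  - rewrite <- (circle_mean_holomorphic rho r (fun z => r * Cconj c * q z)%C); [| |lra].
    + apply angle_integral_ext. intros t. f_equal. rewrite Cmult_conj, Cpow_conj.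
      transitivity (r * Cconj c * q (r * cis t)%C * (cis t * Cconj (cis t)))%C; [simpl; ring|].
      rewrite cis_mult_conj. ring.
    + apply holomorphic_mult; [apply holomorphic_const|exact Hq].
  - rewrite <- Cmult_assoc, Re_scal. simpl. ring.
Qed.

End harmonic.

(** * Harnack's inequality *)

Lemma has_gradient_translate (rho s : R) (u : C -> R) (q : C -> C) (a : C) :
  Cmod a + s <= rho -> has_gradient rho u q ->
  has_gradient s (fun z => u (a + z)%C) (fun z => q (a + z)%C).
Proof.
  intros Ha Hu gamma t d [D1 D2] Ht. apply (Hu (fun s => a + gamma s)%C).
  - split.
    + rewrite <- (Rplus_0_l (Re d)).
      apply (is_derive_plus (V := R_NormedModule)); [|exact D1].
      apply is_derive_Reals, derivable_pt_lim_const.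
    + rewrite <- (Rplus_0_l (Im d)).
      apply (is_derive_plus (V := R_NormedModule)); [|exact D2].
      apply is_derive_Reals, derivable_pt_lim_const.
  - eapply Rle_lt_trans; [apply Cmod_triangle|]. lra.
Qed.

Lemma has_gradient_const_minus (rho c : R) (u : C -> R) (q : C -> C) :
  has_gradient rho u q -> has_gradient rho (fun z => c - u z) (fun z => (- (1)) * q z)%C.
Proof.
  intros Hu gamma t d Hd Ht.
  replace (Re (- (1) * q (gamma t) * d)) with (0 - Re (q (gamma t) * d))
    by (unfold Re; simpl; ring).
  apply (is_derive_minus (V := R_NormedModule)); [apply is_derive_Reals, derivable_pt_lim_const|].
  now apply Hu.
Qed.

Lemma positive_harmonic_gradient_le_lt (rho r : R) (u : C -> R) (q : C -> C) :
  has_gradient rho u q -> holomorphic rho q -> (forall z, Cmod z < rho -> 0 <= u z) ->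
  0 < r < rho -> r * Cmod (q 0) <= 2 * u 0.
Proof.
  intros Hu Hq Pos Hr. set (K := Cmod (q 0)). set (c := (- q 0)%C).
  assert (HK : 0 <= K) by apply Cmod_ge_0. assert (Hpi := PI_RGT_0).
  assert (Cu : forall t, continuous (fun t => u (r * cis t)%C) t)
    by (intros t; apply (continuous_on_circle rho u q Hu); lra).
  assert (P : 0 <= angle_integral (fun t =>
    K * u (r * cis t)%C + u (r * cis t)%C * Re (c * cis t))).
  { rewrite <- (Rmult_0_r (2 * PI)), <- angle_integral_const.
    apply angle_integral_le; intros t; try solve_continuous.
    assert (B := re_le_Cmod (c * cis t)). rewrite Cmod_mult, Cmod_cis, Rmult_1_r in B.
    unfold c in B. rewrite Cmod_opp in B. fold c K in B. apply Rabs_le_between in B.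
    assert (0 <= u (r * cis t)%C) by (apply Pos; rewrite Cmod_circle; lra). nra. }
  rewrite angle_integral_plus, angle_integral_scal, (circle_mean_harmonic rho u q Hu Hq) in P
    by (lra || intros t; solve_continuous).
  rewrite (circle_fourier_harmonic_1 rho u q Hu Hq) in P by exact Hr.
  replace (Re (Cconj c * q 0)) with (- K ^ 2) in P
    by (unfold K, c; rewrite Cmod2_alt; unfold Re, Im, Cconj; simpl; ring).
  assert (U : 0 <= u 0) by (apply Pos; rewrite Cmod_0; lra).
  destruct (Rle_lt_or_eq_dec 0 K HK) as [K0|<-]; [|lra].
  apply Rmult_le_reg_l with (PI * K); [now apply Rmult_lt_0_compat|]. lra.
Qed.

Lemma positive_harmonic_gradient_le (rho : R) (u : C -> R) (q : C -> C) :
  has_gradient rho u q -> holomorphic rho q -> (forall z, Cmod z < rho -> 0 <= u z) -> 0 < rho ->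
  rho * Cmod (q 0) <= 2 * u 0.
Proof.
  intros Hu Hq Pos Hrho. apply (le_of_vanishing_error _ _ (rho * Cmod (q 0))). intros r Hr.
  assert (G := positive_harmonic_gradient_le_lt rho (rho * r) u q Hu Hq Pos ltac:(nra)). lra.
Qed.

Lemma positive_harmonic_derivative_le (rho r : R) (u : C -> R) (q : C -> C) (w z : C) :
  has_gradient rho u q -> holomorphic rho q -> (forall z, Cmod z < rho -> 0 <= u z) ->
  Cmod w <= r < rho -> Cmod z <= r -> Re (q w * z) <= 2 * r / (rho - r) * u w.
Proof.
  intros Hu Hq Pos Hw Hz. assert (W := Cmod_ge_0 w). assert (Q := Cmod_ge_0 (q w)).
  assert (G : (rho - r) * Cmod (q (w + 0)%C) <= 2 * u (w + 0)%C).
  { apply (positive_harmonic_gradient_le (rho - r) (fun v => u (w + v)%C) (fun v => q (w + v)%C)).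
    - apply has_gradient_translate with rho; [lra|exact Hu].
    - apply holomorphic_translate with rho; [lra|exact Hq].
    - intros v Hv. apply Pos. eapply Rle_lt_trans; [apply Cmod_triangle|]. lra.
    - lra. }
  rewrite Cplus_0_r in G.
  assert (B := Rle_trans _ _ _ (Rle_abs _) (re_le_Cmod (q w * z))). rewrite Cmod_mult in B.
  eapply Rle_trans; [exact B|]. apply Rle_trans with (Cmod (q w) * r);
    [apply Rmult_le_compat_l; lra|].
  apply Rmult_le_reg_l with (rho - r); [lra|].
  replace ((rho - r) * (2 * r / (rho - r) * u w)) with (r * (2 * u w)) by (field; lra).
  replace ((rho - r) * (Cmod (q w) * r)) with (r * ((rho - r) * Cmod (q w))) by ring.
  apply Rmult_le_compat_l; lra.
Qed.

Lemma harnack (rho r : R) (u : C -> R) (q : C -> C) (z : C) :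
  has_gradient rho u q -> holomorphic rho q -> (forall z, Cmod z < rho -> 0 <= u z) ->
  Cmod z <= r < rho -> u z <= exp (2 * r / (rho - r)) * u 0.
Proof.
  intros Hu Hq Pos Hz. assert (Z := Cmod_ge_0 z). set (k := 2 * r / (rho - r)).
  set (v := fun s : R => u (s * z)%C * exp (- k * s)).
  set (dv := fun s : R =>
    Re (q (s * z)%C * z) * exp (- k * s) + u (s * z)%C * (- k * exp (- k * s))).
  assert (M : forall s : R, 0 <= s <= 1 -> Cmod (s * z) <= r).
  { intros s Hs. rewrite Cmod_mult, Cmod_R, Rabs_pos_eq by lra. nra. }
  assert (D : forall s : R, 0 <= s <= 1 -> is_derive v s (dv s)).
  { intros s Hs.
    assert (Dz : is_curve_derive (fun s => s * z)%C s z)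
      by (split; unfold Re, Im; simpl; auto_derive; auto; ring).
    assert (De : is_derive (fun s => exp (- k * s)) s (- k * exp (- k * s)))
      by (auto_derive; auto; ring).
    assert (Du := Hu _ s z Dz (Rle_lt_trans _ _ _ (M s Hs) (proj2 Hz))).
    exact (is_derive_mult (K := R_AbsRing) _ _ s _ _ Du De Rmult_comm). }
  destruct (MVT_gen v 0 1 dv) as [c [Hc E]]; rewrite Rmin_left, Rmax_right in * by lra.
  - intros s Hs. apply D. lra.
  - intros s Hs. apply continuity_pt_filterlim.
    apply (ex_derive_continuous (V := R_NormedModule) v). exists (dv s). now apply D.
  - assert (B := positive_harmonic_derivative_le rho r u q (c * z) z Hu Hq Pos
      (conj (M c Hc) (proj2 Hz)) (proj1 Hz)).
    fold k in B. apply (Rmult_le_compat_r (exp (- k * c))) in B; [|left; apply exp_pos].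
    unfold v, dv in E. rewrite Cmult_1_l, Cmult_0_l, Rmult_0_r, exp_0 in E.
    assert (X : exp k * exp (- k * 1) = 1)
      by (rewrite <- exp_plus; replace (k + - k * 1) with 0 by ring; apply exp_0).
    replace (u z) with (exp k * (u z * exp (- k * 1)))
      by (transitivity (u z * (exp k * exp (- k * 1))); [ring|rewrite X; ring]).
    apply Rmult_le_compat_l; [left; apply exp_pos|lra].
Qed.

(* Harnack's inequality for [ln M - ln |f|]. *)
Lemma zero_free_lower_bound (rho r M : R) : 0 <= r < rho -> 1 <= M -> exists m, 0 < m /\
  forall f f' : C -> C, (forall z, Cmod z < rho -> is_C_derive f z (f' z)) -> holomorphic rho f' ->
    (forall z, Cmod z < rho -> f z <> 0 /\ Cmod (f z) <= M) -> f 0 = 1 ->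
    forall z, Cmod z <= r -> m <= Cmod (f z).
Proof.
  intros Hr HM. set (K := exp (2 * r / (rho - r))).
  exists (exp (ln M - K * ln M)). split; [apply exp_pos|].
  intros f f' Df Hf' Hf f0 z Hz.
  assert (Hfz : forall w, Cmod w < rho -> 0 < Cmod (f w)) by (intros; now apply Cmod_gt_0, Hf).
  assert (Hfh : holomorphic rho f).
  { exists f'. intros w Hw. split; auto. now apply holomorphic_continuous with rho. }
  assert (H := harnack rho r (fun w => ln M - ln (Cmod (f w)))
    (fun w => (- (1)) * (f' w / f w))%C z).
  cbv beta in H. fold K in H. rewrite f0, Cmod_1, ln_1, Rminus_0_r in H.
  apply Rnot_lt_le. intros L. apply ln_increasing in L; [|apply Hfz; lra]. rewrite ln_exp in L.
  cut (ln M - ln (Cmod (f z)) <= K * ln M); [lra|]. apply H.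
  - apply has_gradient_const_minus, has_gradient_ln_Cmod; auto. intros; now apply Hf.
  - apply holomorphic_mult; [apply holomorphic_const|]. apply holomorphic_mult; auto.
    apply holomorphic_inv; auto. intros; now apply Hf.
  - intros w Hw. specialize (Hfz w Hw). cut (ln (Cmod (f w)) <= ln M); [lra|].
    apply ln_le; auto. now apply Hf.
  - lra.
Qed.

(** * Fourier coefficients of the logarithm of a power series *)

(* The [n]-th coefficient of the formal quotient of [p] by [b], for [b 0 = 1]. *)
Fixpoint quotient_coeff (n : nat) (p b : nat -> C) : C :=
  match n with
  | O => p 0%nat
  | S n => quotient_coeff n (fun k => shift p k - p 0%nat * shift b k)%C b
  end.

Lemma angle_integral_cis_pow (c : C) (n : nat) :
  angle_integral (fun t => Re (c * cis t ^ S n)) = 0.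
Proof.
  transitivity (2 * PI * Re (c * 0 ^ S n)); [|simpl; ring].
  rewrite <- (circle_mean_holomorphic 2 1 (fun z => c * z ^ S n)%C); [|apply holomorphic_mult|lra].
  - apply angle_integral_ext. intros t. now rewrite Cmult_1_l.
  - apply holomorphic_const.
  - apply holomorphic_pow.
Qed.

Lemma angle_integral_conj_cis_pow (c : C) (n : nat) :
  angle_integral (fun t => Re (c * Cconj (cis t) ^ S n)) = 0.
Proof.
  rewrite <- (angle_integral_cis_pow (Cconj c) n). apply angle_integral_ext. intros t.
  rewrite <- re_conj, Cmult_conj, Cpow_conj, Cconj_conj. reflexivity.
Qed.

Section log_coefficients.
Variables (rho r : R) (b : nat -> C).
Hypothesis Hr : 0 < r < rho.
Hypothesis Hb : convergent_on_disk rho b.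
Hypothesis b0 : b 0%nat = 1.
Hypothesis b_zero_free : forall z, Cmod z < rho -> ps b z <> 0.

Lemma holomorphic_ps_div (p : nat -> C) : convergent_on_disk rho p ->
  holomorphic rho (fun z => ps p z / ps b z)%C.
Proof.
  intros Hp. apply holomorphic_mult; [now apply holomorphic_ps|].
  apply holomorphic_inv; auto. now apply holomorphic_ps.
Qed.

Lemma ps_div_unfold (p : nat -> C) (z : C) : convergent_on_disk rho p -> Cmod z < rho ->
  (ps p z / ps b z = p 0%nat
    + z * (ps (fun k => shift p k - p 0%nat * shift b k) z / ps b z))%C.
Proof.
  intros Hp Hz. rewrite (ps_minus_scal rho) by auto using convergent_on_disk_shift.
  assert (E : ps b z = (1 + z * ps (shift b) z)%C) by (rewrite <- b0; now apply ps_unfold with rho).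
  rewrite (ps_unfold rho p) by assumption.
  assert (N := b_zero_free z Hz). rewrite E in *. field. exact N.
Qed.

Lemma angle_integral_ps_div (n : nat) (p : nat -> C) (c : C) : convergent_on_disk rho p ->
  angle_integral (fun t => Re (c * Cconj (cis t) ^ n * (ps p (r * cis t) / ps b (r * cis t)))) =
  2 * PI * Re (c * r ^ n * quotient_coeff n p b).
Proof.
  revert p c. induction n as [|n IH]; intros p c Hp.
  - simpl quotient_coeff.
    transitivity (2 * PI * Re (c * (ps p 0 / ps b 0))).
    + rewrite <- (circle_mean_holomorphic rho r (fun z => c * (ps p z / ps b z))%C); [| |lra].
      * apply angle_integral_ext. intros t. f_equal. simpl. ring.
      * apply holomorphic_mult; [apply holomorphic_const|now apply holomorphic_ps_div].
    + rewrite !(ps_at_0 rho), b0 by (auto; lra). do 2 f_equal. simpl. field.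
  - set (p1 := fun k => (shift p k - p 0%nat * shift b k)%C).
    assert (Hp1 : convergent_on_disk rho p1)
      by (apply convergent_on_disk_minus_scal; now apply convergent_on_disk_shift).
    assert (Cf : forall t, C_continuous (fun t => ps p1 (r * cis t) / ps b (r * cis t))%C t).
    { intros t. apply (C_continuous_on_circle rho (fun z => ps p1 z / ps b z)%C); [|lra].
      intros z. apply holomorphic_continuous. now apply holomorphic_ps_div. }
    rewrite (angle_integral_ext _ (fun t => Re (c * p 0%nat * Cconj (cis t) ^ S n) +
      Re (c * r * Cconj (cis t) ^ n * (ps p1 (r * cis t) / ps b (r * cis t))))).
    + rewrite angle_integral_plus by (intros t; solve_continuous).
      rewrite angle_integral_conj_cis_pow, IH by exact Hp1.
      change (quotient_coeff (S n) p b) with (quotient_coeff n p1 b).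
      rewrite Rplus_0_l. do 2 f_equal. simpl. ring.
    + intros t. rewrite <- Re_plus. f_equal.
      rewrite (ps_div_unfold p) by (rewrite ?Cmod_circle; auto; lra). fold p1.
      transitivity (c * p 0%nat * Cconj (cis t) ^ S n + c * r * Cconj (cis t) ^ n
        * (ps p1 (r * cis t) / ps b (r * cis t)) * (cis t * Cconj (cis t)))%C; [simpl; ring|].
      rewrite cis_mult_conj. ring.
Qed.

Lemma has_gradient_ln_ps :
  has_gradient rho (fun z => ln (Cmod (ps b z))) (fun z => ps (deriv_seq b) z / ps b z)%C.
Proof. apply has_gradient_ln_Cmod; auto. intros z Hz. now apply is_C_derive_ps with rho. Qed.

Lemma ln_ps_mean : angle_integral (fun t => ln (Cmod (ps b (r * cis t)))) = 0.
Proof.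
  rewrite (circle_mean_harmonic rho (fun z => ln (Cmod (ps b z))) _ has_gradient_ln_ps).
  - rewrite (ps_at_0 rho), b0, Cmod_1, ln_1 by (auto; lra). ring.
  - apply holomorphic_ps_div. now apply convergent_on_disk_deriv.
  - lra.
Qed.

Lemma ln_ps_fourier (c : C) (n : nat) :
  INR n * angle_integral (fun t => ln (Cmod (ps b (r * cis t))) * Re (c * cis t ^ n)) =
  PI * Re (Cconj c * r ^ n * quotient_coeff n (nmul b) b).
Proof.
  apply Rmult_eq_reg_l with 2; [|lra]. rewrite <- !Rmult_assoc.
  assert (Hq : holomorphic rho (fun z => ps (deriv_seq b) z / ps b z)%C)
    by (apply holomorphic_ps_div; now apply convergent_on_disk_deriv).
  rewrite (circle_fourier_harmonic rho (fun z => ln (Cmod (ps b z))) _ has_gradient_ln_ps Hq)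
    by lra.
  rewrite <- angle_integral_ps_div by now apply convergent_on_disk_nmul.
  apply angle_integral_ext. intros t. f_equal.
  rewrite (ps_nmul rho) by (rewrite ?Cmod_circle; auto; lra).
  rewrite Cmult_conj, Cpow_conj. unfold Cdiv. ring.
Qed.

End log_coefficients.

Lemma quotient_coeff_nmul_2 (b : nat -> C) :
  quotient_coeff 2 (nmul b) b = (2 * b 2%nat - b 1%nat ^ 2)%C.
Proof. cbn -[INR Cpow]. unfold shift, nmul. rewrite !INR_IZR_INZ. simpl. ring. Qed.

Lemma quotient_coeff_nmul_3 (b : nat -> C) :
  quotient_coeff 3 (nmul b) b = (3 * b 3%nat - 3 * (b 1%nat * b 2%nat) + b 1%nat ^ 3)%C.
Proof. cbn -[INR Cpow]. unfold shift, nmul. rewrite !INR_IZR_INZ. simpl. ring. Qed.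

Lemma quotient_coeff_nmul_4 (b : nat -> C) :
  quotient_coeff 4 (nmul b) b = (4 * b 4%nat - 4 * (b 1%nat * b 3%nat) - 2 * b 2%nat ^ 2
    + 4 * (b 1%nat ^ 2 * b 2%nat) - b 1%nat ^ 4)%C.
Proof. cbn -[INR Cpow]. unfold shift, nmul. rewrite !INR_IZR_INZ. simpl. ring. Qed.

(** * Double integrals over the torus *)

Definition continuous2 (f : R -> R -> R) : Prop :=
  forall p : R * R, continuous (fun p : R * R => f (fst p) (snd p)) p.

Ltac solve_continuous2 :=
  let p := fresh "p" in
  intros p;
  repeat match goal with H : continuous2 _ |- _ => specialize (H p) end;
  solve_continuous.

Definition double_integral (f : R -> R -> R) : R :=
  angle_integral (fun s => angle_integral (fun t => f t s)).

Lemma continuous2_2d (f : R -> R -> R) (x y : R) : continuous2 f -> continuity_2d_pt f x y.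
Proof. intros H. apply continuity_2d_pt_filterlim. exact (H (x, y)). Qed.

Lemma continuous2_section (f : R -> R -> R) (t s : R) :
  continuous2 f -> continuous (fun t => f t s) t.
Proof.
  intros H. apply (continuity_2d_pt_section_r (fun s t => f t s)).
  now apply continuity_2d_pt_swap, continuous2_2d.
Qed.

Lemma continuous2_inner (f : R -> R -> R) (s : R) :
  continuous2 f -> continuous (fun s => angle_integral (fun t => f t s)) s.
Proof.
  intros H. apply (continuous_RInt_param (fun s t => f t s)). intros x y.
  now apply continuity_2d_pt_swap, continuous2_2d.
Qed.

Lemma double_integral_ext (f g : R -> R -> R) :
  (forall t s, f t s = g t s) -> double_integral f = double_integral g.
Proof. intros H. apply angle_integral_ext. intros s. now apply angle_integral_ext. Qed.

Lemma double_integral_plus (f g : R -> R -> R) : continuous2 f -> continuous2 g ->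
  double_integral (fun t s => f t s + g t s) = double_integral f + double_integral g.
Proof.
  intros Hf Hg. unfold double_integral.
  rewrite <- angle_integral_plus by (intros s; now apply continuous2_inner).
  apply angle_integral_ext. intros s.
  apply angle_integral_plus; intros t; now apply continuous2_section.
Qed.

Lemma double_integral_scal (f : R -> R -> R) (c : R) : continuous2 f ->
  double_integral (fun t s => c * f t s) = c * double_integral f.
Proof.
  intros Hf. unfold double_integral.
  rewrite <- angle_integral_scal by (intros s; now apply continuous2_inner).
  apply angle_integral_ext. intros s.
  apply angle_integral_scal; intros t; now apply continuous2_section.
Qed.

Lemma double_integral_le (f g : R -> R -> R) : continuous2 f -> continuous2 g ->
  (forall t s, f t s <= g t s) -> double_integral f <= double_integral g.
Proof.
  intros Hf Hg H. apply angle_integral_le; try (intros s; now apply continuous2_inner).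
  intros s. apply angle_integral_le; auto; intros t; now apply continuous2_section.
Qed.

Lemma double_integral_product (u v : R -> R) :
  (forall t, continuous u t) -> (forall t, continuous v t) ->
  double_integral (fun t s => u t * v s) = angle_integral u * angle_integral v.
Proof.
  intros Hu Hv. unfold double_integral. rewrite <- angle_integral_scal by exact Hv.
  apply angle_integral_ext. intros s.
  rewrite (Rmult_comm _ (v s)), <- angle_integral_scal by exact Hu.
  apply angle_integral_ext. intros t. apply Rmult_comm.
Qed.

Lemma double_integral_const (c : R) : double_integral (fun _ _ => c) = (2 * PI) ^ 2 * c.
Proof. unfold double_integral. rewrite !angle_integral_const. ring. Qed.

Lemma continuous2_shear (f : R -> R -> R) :
  continuous2 f -> continuous2 (fun s theta => f (s + theta) s).
Proof.
  intros Hf p.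
  apply (continuous_comp_2 (fun p : R * R => fst p + snd p) (fun p => fst p) f);
    [solve_continuous..|apply Hf].
Qed.

Lemma double_integral_shear (f : R -> R -> R) : continuous2 f ->
  (forall t s, f (t + 2 * PI) s = f t s) ->
  double_integral f = angle_integral (fun theta => angle_integral (fun s => f (s + theta) s)).
Proof.
  intros Hf P.
  transitivity (angle_integral (fun s => angle_integral (fun theta => f (s + theta) s))).
  - apply angle_integral_ext. intros s. symmetry.
    transitivity (angle_integral (fun t => f (t + s) s)).
    + apply angle_integral_ext. intros t. now rewrite Rplus_comm.
    + apply (RInt_periodic_shift (fun t => f t s)); auto. intros t. now apply continuous2_section.
  - apply (RInt_swap (fun s theta => f (s + theta) s)); [generalize PI_RGT_0; lra|].
    intros x y. now apply continuous2_2d, continuous2_shear.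
Qed.

(** * Positivity of the logarithmic energy *)

Definition continuous_family (es : list (R -> R)) : Prop :=
  List.Forall (fun e => forall t, continuous e t) es.

Fixpoint gram (es : list (R -> R)) (t s : R) : R :=
  match es with
  | [] => 0
  | e :: es => e t * e s + gram es t s
  end.

Lemma continuous2_gram (es : list (R -> R)) :
  continuous_family es -> continuous2 (gram es).
Proof.
  induction 1 as [|e es He _ IH]; simpl; solve_continuous2.
Qed.

Lemma gram_pow_nonneg (es : list (R -> R)) (n : nat) (u : R -> R) :
  continuous_family es -> (forall t, continuous u t) ->
  0 <= double_integral (fun t s => gram es t s ^ n * (u t * u s)).
Proof.
  intros Hes. assert (Cg := continuous2_gram es Hes). revert u.
  induction n as [|n IH]; intros u Hu.
  - rewrite (double_integral_ext _ (fun t s => u t * u s)) by (intros; simpl; ring).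
    rewrite double_integral_product by assumption. apply Rle_0_sqr.
  - assert (Sub : forall fs, continuous_family fs ->
      0 <= double_integral (fun t s => gram fs t s * (gram es t s ^ n * (u t * u s)))).
    { induction 1 as [|f fs Hf Hfs IHfs]; simpl.
      - rewrite (double_integral_ext _ (fun _ _ => 0)) by (intros; ring).
        rewrite double_integral_const. lra.
      - assert (Cf := continuous2_gram fs Hfs).
        rewrite (double_integral_ext _ (fun t s =>
          gram es t s ^ n * ((fun t => f t * u t) t * (fun t => f t * u t) s)
          + gram fs t s * (gram es t s ^ n * (u t * u s)))) by (intros; ring).
        rewrite double_integral_plus.
        + apply Rplus_le_le_0_compat; [|exact IHfs]. apply IH. intros t. solve_continuous.
        + solve_continuous2.
        + solve_continuous2. }
    rewrite (double_integral_ext _ (fun t s => gram es t s * (gram es t s ^ n * (u t * u s))))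
      by (intros; simpl; ring).
    now apply Sub.
Qed.

Fixpoint log_partial_sum (n : nat) (x : R) : R :=
  match n with
  | O => 0
  | S n => log_partial_sum n x + / INR (S n) * x ^ S n
  end.

Lemma log_partial_sum_derive (n : nat) (x : R) : x <> 1 ->
  is_derive (log_partial_sum n) x ((1 - x ^ n) / (1 - x)).
Proof.
  intros Hx. induction n as [|n IH].
  - simpl. replace ((1 - 1) / (1 - x)) with 0 by (field; lra).
    apply is_derive_Reals, derivable_pt_lim_const.
  - replace ((1 - x ^ S n) / (1 - x)) with ((1 - x ^ n) / (1 - x) + x ^ n) by (simpl; field; lra).
    apply (is_derive_plus (V := R_NormedModule)
      (log_partial_sum n) (fun x => / INR (S n) * x ^ S n)); [exact IH|].
    replace (x ^ n) with (/ INR (S n) * (INR (S n) * 1 * x ^ pred (S n)))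
      by (simpl pred; field; now apply not_0_INR).
    apply is_derive_scal, is_derive_pow. exact (is_derive_id (K := R_AbsRing) x).
Qed.

Lemma log_remainder_le (n : nat) (x q : R) : Rabs x <= q < 1 ->
  Rabs (- ln (1 - x) - log_partial_sum n x) <= q ^ n / (1 - q).
Proof.
  intros Hx. assert (Q := Rabs_pos x).
  destruct (MVT_cor4 (fun y => - ln (1 - y) - log_partial_sum n y) (fun y => y ^ n / (1 - y)) 0
    (Rabs x)) with (b := x) as [c [E Hc]].
  - intros y Hy. rewrite Rminus_0_r in Hy. apply Rabs_le_between in Hy.
    assert (y < 1) by lra.
    replace (y ^ n / (1 - y)) with (/ (1 - y) - (1 - y ^ n) / (1 - y)) by (field; lra).
    apply (is_derive_minus (V := R_NormedModule)); [|apply log_partial_sum_derive; lra].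
    auto_derive; [lra|field; lra].
  - rewrite Rminus_0_r. lra.
  - rewrite !Rminus_0_r in *. rewrite ln_1 in E.
    assert (L0 : log_partial_sum n 0 = 0).
    { clear. induction n as [|n IH]; [reflexivity|]. simpl. rewrite IH. ring. }
    rewrite L0 in E. replace (- ln (1 - x) - log_partial_sum n x) with (c ^ n / (1 - c) * x) by lra.
    assert (c <= Rabs c) by apply Rle_abs.
    assert (P := Rabs_pos c).
    unfold Rdiv. rewrite !Rabs_mult, <- RPow_abs, (Rabs_pos_eq (/ _)) by
      (left; apply Rinv_0_lt_compat; lra).
    assert (C1 : Rabs c ^ n <= q ^ n) by (apply pow_incr; lra).
    assert (C2 : / (1 - c) <= / (1 - q)) by (apply Rinv_le_contravar; lra).
    assert (C3 : 0 <= Rabs c ^ n) by (apply pow_le; lra).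
    assert (C4 : 0 < / (1 - c)) by (apply Rinv_0_lt_compat; lra).
    apply Rle_trans with (q ^ n * / (1 - q) * 1); [|lra].
    apply Rmult_le_compat; try lra; [apply Rmult_le_pos; lra|].
    apply Rmult_le_compat; lra.
Qed.

Lemma continuous2_log_partial_sum (n : nat) (f : R -> R -> R) :
  continuous2 f -> continuous2 (fun t s => log_partial_sum n (f t s)).
Proof.
  intros Hf. induction n as [|n IH]; simpl; solve_continuous2.
Qed.

Lemma log_partial_sum_gram_nonneg (es : list (R -> R)) (n : nat) (u : R -> R) :
  continuous_family es -> (forall t, continuous u t) ->
  0 <= double_integral (fun t s => log_partial_sum n (gram es t s) * (u t * u s)).
Proof.
  intros Hes Hu. assert (Cg := continuous2_gram es Hes). induction n as [|n IH].
  - rewrite (double_integral_ext _ (fun _ _ => 0)) by (intros; simpl; ring).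
    rewrite double_integral_const. lra.
  - rewrite (double_integral_ext _ (fun t s => log_partial_sum n (gram es t s) * (u t * u s)
      + / INR (S n) * (gram es t s ^ S n * (u t * u s)))) by (intros; simpl; ring).
    assert (Cl := continuous2_log_partial_sum n _ Cg).
    rewrite double_integral_plus, double_integral_scal by solve_continuous2.
    apply Rplus_le_le_0_compat; [exact IH|]. apply Rmult_le_pos; [|now apply gram_pow_nonneg].
    left. apply Rinv_0_lt_compat, lt_0_INR. lia.
Qed.

Lemma continuous2_ln_one_minus (f : R -> R -> R) :
  continuous2 f -> (forall t s, f t s < 1) -> continuous2 (fun t s => - ln (1 - f t s)).
Proof.
  intros Hf H p. assert (Hfp := Hf p).
  apply (continuous_opp (V := R_NormedModule)), continuous_ln_comp; [|solve_continuous].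
  generalize (H (fst p) (snd p)). lra.
Qed.

Lemma log_gram_nonneg (es : list (R -> R)) (u : R -> R) (q B : R) :
  continuous_family es -> (forall t, continuous u t) ->
  (forall t, Rabs (u t) <= B) -> q < 1 -> (forall t s, Rabs (gram es t s) <= q) ->
  0 <= double_integral (fun t s => - ln (1 - gram es t s) * (u t * u s)).
Proof.
  intros Hes Hu HB Hq Hg. assert (Cg := continuous2_gram es Hes).
  assert (Q0 : 0 <= q) by (eapply Rle_trans; [apply Rabs_pos|apply (Hg 0 0)]).
  assert (Cln : continuous2 (fun t s => - ln (1 - gram es t s))).
  { apply continuous2_ln_one_minus; [exact Cg|]. intros t s.
    generalize (Rle_abs (gram es t s)) (Hg t s). lra. }
  set (J := double_integral _).
  assert (Step : forall n, - ((2 * PI) ^ 2 * (B ^ 2 / (1 - q))) * q ^ n <= J).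
  { intros n. set (rem := fun t s => - ln (1 - gram es t s) - log_partial_sum n (gram es t s)).
    assert (Cl := continuous2_log_partial_sum n _ Cg).
    assert (Cr : continuous2 rem) by (unfold rem; solve_continuous2).
    assert (Split : J = double_integral (fun t s => log_partial_sum n (gram es t s) * (u t * u s))
      + double_integral (fun t s => rem t s * (u t * u s))).
    { rewrite <- double_integral_plus by solve_continuous2.
      apply double_integral_ext. intros t s. unfold rem. ring. }
    assert (Tail : double_integral (fun _ _ => - (q ^ n / (1 - q) * (B * B)))
      <= double_integral (fun t s => rem t s * (u t * u s))).
    { apply double_integral_le; [solve_continuous2..|].
      intros t s. cut (Rabs (rem t s * (u t * u s)) <= q ^ n / (1 - q) * (B * B)).
      { intros E. apply Rabs_le_between in E. lra. }
      rewrite !Rabs_mult.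
      assert (Rem := log_remainder_le n (gram es t s) q (conj (Hg t s) Hq)).
      repeat apply Rmult_le_compat; auto using Rabs_pos, Rmult_le_pos. }
    rewrite double_integral_const in Tail.
    assert (P := log_partial_sum_gram_nonneg es n u Hes Hu). unfold Rdiv in *. lra. }
  assert (Lim := is_lim_seq_scal_l _ (- ((2 * PI) ^ 2 * (B ^ 2 / (1 - q)))) _
    (is_lim_seq_geom q ltac:(rewrite Rabs_pos_eq; lra))).
  apply (is_lim_seq_le _ (fun _ => J) _ (Finite J) Step) in Lim; [|apply is_lim_seq_const].
  simpl in Lim. lra.
Qed.

(* Regularised stereographic projection: with [n p = |p|^2 + eps / 2] the Gram kernel
   [X = (1 + n p * n w + 2 <p, w>) / ((1 + n p) (1 + n w))] satisfies
   [1 - X = (|p - w|^2 + eps) / ((1 + n p) (1 + n w))], and the logarithm of a factor depending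
   on one variable only integrates to zero against a neutral charge. *)
Section log_energy.
Variables (gamma : R -> C) (u : R -> R) (eps A B : R).
Hypothesis C_gamma : forall t, C_continuous gamma t.
Hypothesis gamma_bound : forall t, Cmod (gamma t) <= A.
Hypothesis C_u : forall t, continuous u t.
Hypothesis u_bound : forall t, Rabs (u t) <= B.
Hypothesis u_neutral : angle_integral u = 0.
Hypothesis eps_pos : 0 < eps.

Let reg_norm (t : R) : R := Cmod (gamma t) ^ 2 + eps / 2.

Let weight (t : R) : R := / (1 + reg_norm t).

Let stereographic : list (R -> R) :=
  [weight; fun t => reg_norm t * weight t;
   fun t => Re (gamma t) * weight t; fun t => Re (gamma t) * weight t;
   fun t => Im (gamma t) * weight t; fun t => Im (gamma t) * weight t].

Lemma reg_norm_pos (t : R) : 0 < reg_norm t.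
Proof. unfold reg_norm. generalize (pow2_ge_0 (Cmod (gamma t))). lra. Qed.

Lemma reg_norm_le (t : R) : reg_norm t <= A ^ 2 + eps / 2.
Proof.
  unfold reg_norm. apply Rplus_le_compat_r, pow_incr. split; [apply Cmod_ge_0|apply gamma_bound].
Qed.

Lemma continuous_reg_norm (t : R) : continuous reg_norm t.
Proof. unfold reg_norm. solve_continuous. Qed.

Lemma continuous_stereographic : continuous_family stereographic.
Proof.
  assert (Ch := continuous_reg_norm).
  assert (Cw : forall t, continuous weight t).
  { intros t. apply continuous_inv; [generalize (reg_norm_pos t); lra|solve_continuous]. }
  unfold stereographic. repeat constructor; intros t; solve_continuous.
Qed.

Lemma one_pm_gram_stereographic (t s : R) :
  1 - gram stereographic t s =
    (Cmod (gamma t - gamma s) ^ 2 + eps) / ((1 + reg_norm t) * (1 + reg_norm s)) /\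
  1 + gram stereographic t s =
    (2 + 2 * reg_norm t * reg_norm s + Cmod (gamma t + gamma s) ^ 2 + eps)
      / ((1 + reg_norm t) * (1 + reg_norm s)).
Proof.
  assert (Ht := reg_norm_pos t). assert (Hs := reg_norm_pos s). rewrite !Cmod2_alt.
  assert (Et : reg_norm t = Re (gamma t) ^ 2 + Im (gamma t) ^ 2 + eps / 2)
    by (unfold reg_norm; now rewrite Cmod2_alt).
  assert (Es : reg_norm s = Re (gamma s) ^ 2 + Im (gamma s) ^ 2 + eps / 2)
    by (unfold reg_norm; now rewrite Cmod2_alt).
  unfold stereographic, weight. simpl gram. rewrite Et, Es in *.
  unfold Re, Im in *. simpl in *. split; field; lra.
Qed.

Lemma gram_stereographic_lt_1 : exists q, q < 1 /\ forall t s, Rabs (gram stereographic t s) <= q.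
Proof.
  set (M := 1 + (A ^ 2 + eps / 2)).
  assert (HM : 1 < M) by (generalize (reg_norm_pos 0) (reg_norm_le 0); unfold M; lra).
  assert (HM2 : 0 < M * M) by nra.
  exists (1 - eps / (M * M)). split.
  { assert (0 < eps / (M * M)) by now apply Rdiv_lt_0_compat. lra. }
  intros t s. destruct (one_pm_gram_stereographic t s) as [E1 E2].
  assert (Ht := reg_norm_pos t). assert (Hs := reg_norm_pos s).
  assert (D : 0 < (1 + reg_norm t) * (1 + reg_norm s) <= M * M).
  { assert (Lt := reg_norm_le t). assert (Ls := reg_norm_le s).
    split; [nra|]. apply Rmult_le_compat; unfold M; lra. }
  assert (F : forall x, eps <= x -> eps / (M * M) <= x / ((1 + reg_norm t) * (1 + reg_norm s))).
  { intros x Hx. apply Rmult_le_compat; try lra.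
    - left. now apply Rinv_0_lt_compat.
    - now apply Rinv_le_contravar. }
  apply Rabs_le_between. split.
  - cut (eps / (M * M) <= 1 + gram stereographic t s); [lra|]. rewrite E2. apply F.
    generalize (pow2_ge_0 (Cmod (gamma t + gamma s))). nra.
  - cut (eps / (M * M) <= 1 - gram stereographic t s); [lra|]. rewrite E1. apply F.
    generalize (pow2_ge_0 (Cmod (gamma t - gamma s))). lra.
Qed.

Lemma log_energy_nonpos :
  double_integral (fun t s => ln (Cmod (gamma t - gamma s) ^ 2 + eps) * (u t * u s)) <= 0.
Proof.
  assert (Hf := continuous_stereographic). assert (Ch := continuous_reg_norm).
  destruct gram_stereographic_lt_1 as [q [Hq Hg]].
  assert (P := log_gram_nonneg stereographic u q B Hf C_u u_bound Hq Hg).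
  set (w := fun t => ln (1 + reg_norm t) * u t).
  assert (Cw : forall t, continuous w t).
  { intros t. apply (continuous_mult (K := R_AbsRing)); [|apply C_u].
    apply continuous_ln_comp; [generalize (reg_norm_pos t); lra|solve_continuous]. }
  assert (Cln : continuous2 (fun t s => - ln (1 - gram stereographic t s))).
  { apply continuous2_ln_one_minus; [now apply continuous2_gram|]. intros t s.
    generalize (Rle_abs (gram stereographic t s)) (Hg t s). lra. }
  rewrite (double_integral_ext _ (fun t s => -1 * (- ln (1 - gram stereographic t s) * (u t * u s))
    + (w t * u s + u t * w s))).
  - rewrite !double_integral_plus, double_integral_scal, !double_integral_product, u_neutral
      by (solve_continuous2 || assumption).
    lra.
  - intros t s. destruct (one_pm_gram_stereographic t s) as [E _]. unfold w. rewrite E.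
    assert (Ht := reg_norm_pos t). assert (Hs := reg_norm_pos s).
    assert (Hd := pow2_ge_0 (Cmod (gamma t - gamma s))).
    rewrite ln_div, ln_mult by (try apply Rmult_lt_0_compat; lra). ring.
Qed.

End log_energy.

(** * The comparison kernel of the unit circle *)

Lemma Cmod2_one_minus (l : R) (x y : C) : Cmod x = 1 -> Cmod y = 1 -> l <> 0 ->
  Cmod (1 - l * (x * Cconj y)) ^ 2 = l * (Cmod (x - y) ^ 2 + (1 - l) ^ 2 / l).
Proof.
  intros Hx Hy Hl. assert (X := Cmod2_alt x). assert (Y := Cmod2_alt y).
  rewrite Hx in X. rewrite Hy in Y. rewrite !Cmod2_alt.
  replace (l * ((Re (x - y) ^ 2 + Im (x - y) ^ 2) + (1 - l) ^ 2 / l))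
    with (l * (Re (x - y) ^ 2 + Im (x - y) ^ 2) + (1 - l) ^ 2) by (field; exact Hl).
  destruct x as [x1 x2], y as [y1 y2]. unfold Re, Im, Cconj in *. simpl in *.
  assert (Z : (x1 * (x1 * 1) + x2 * (x2 * 1)) * (y1 * (y1 * 1) + y2 * (y2 * 1)) = 1)
    by (rewrite <- X, <- Y; ring).
  nra.
Qed.

Lemma poisson_kernel (w : C) : Cmod w < 1 ->
  Re ((1 + w) / (1 - w)) = (1 - Cmod w ^ 2) / Cmod (1 - w) ^ 2.
Proof.
  intros Hw.
  assert (N : 0 < Cmod (1 - w)).
  { generalize (Cmod_triangle (1 - w) w). replace (1 - w + w)%C with (RtoC 1) by ring.
    rewrite Cmod_1. lra. }
  assert (P : 0 < Cmod (1 - w) ^ 2) by now apply pow_lt. rewrite !Cmod2_alt in *.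
  destruct w as [x y]. unfold Re, Im in *. simpl in *. field. lra.
Qed.

Lemma one_minus_neq_0 (w : C) : Cmod w < 1 -> (1 - w)%C <> 0.
Proof.
  intros Hw E. assert (E1 : w = 1) by (transitivity (1 - (1 - w))%C; [ring|rewrite E; ring]).
  rewrite E1, Cmod_1 in Hw. lra.
Qed.

Lemma Cmod_mult_lt_1 (kappa z : C) : Cmod kappa < 1 -> Cmod z < 2 / (1 + Cmod kappa) ->
  Cmod (kappa * z) < 1.
Proof.
  intros Hk Hz. assert (K := Cmod_ge_0 kappa). assert (Z := Cmod_ge_0 z).
  apply Rmult_lt_compat_r with (r := 1 + Cmod kappa) in Hz; [|lra].
  unfold Rdiv in Hz. rewrite Rmult_assoc, Rinv_l in Hz by lra. rewrite Cmod_mult. nra.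
Qed.

Lemma poisson_mean (kappa : C) : Cmod kappa < 1 ->
  angle_integral (fun t => / Cmod (1 - kappa * cis t) ^ 2) = 2 * PI / (1 - Cmod kappa ^ 2).
Proof.
  intros Hk. assert (K := Cmod_ge_0 kappa). assert (K2 : 0 < 1 - Cmod kappa ^ 2) by nra.
  set (rho := 2 / (1 + Cmod kappa)).
  assert (Hrho : 1 < rho).
  { apply Rmult_lt_reg_r with (1 + Cmod kappa); [lra|].
    unfold rho, Rdiv. rewrite Rmult_assoc, Rinv_l; lra. }
  assert (M : forall t, Cmod (kappa * cis t) = Cmod kappa)
    by (intros t; rewrite Cmod_mult, Cmod_cis; ring).
  assert (Mean : angle_integral (fun t =>
    Re ((1 + kappa * (1 * cis t)) / (1 - kappa * (1 * cis t)))) = 2 * PI).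
  { rewrite (circle_mean_holomorphic rho 1 (fun z => (1 + kappa * z) / (1 - kappa * z))%C);
      [| |lra].
    - rewrite Cmult_0_r. unfold Re. simpl. field.
    - apply holomorphic_mult; [|apply holomorphic_inv].
      + apply holomorphic_plus; [apply holomorphic_const|].
        apply holomorphic_mult; [apply holomorphic_const|apply holomorphic_id].
      + intros z Hz. now apply one_minus_neq_0, Cmod_mult_lt_1.
      + apply holomorphic_minus; [apply holomorphic_const|].
        apply holomorphic_mult; [apply holomorphic_const|apply holomorphic_id]. }
  apply Rmult_eq_reg_l with (1 - Cmod kappa ^ 2); [|lra].
  replace ((1 - Cmod kappa ^ 2) * (2 * PI / (1 - Cmod kappa ^ 2))) with (2 * PI) by (field; lra).
  rewrite <- Mean, <- angle_integral_scal.
  - apply angle_integral_ext. intros t. rewrite Cmult_1_l, poisson_kernel by now rewrite M.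
    now rewrite M.
  - intros t. apply continuous_inv.
    + apply pow_nonzero, Rgt_not_eq, Cmod_gt_0, one_minus_neq_0. now rewrite M.
    + solve_continuous.
Qed.

Definition linear_factor (kappa : C) (k : nat) : C :=
  match k with
  | O => 1
  | S O => (- kappa)%C
  | _ => 0
  end.

Lemma convergent_linear_factor (rho : R) (kappa : C) :
  convergent_on_disk rho (linear_factor kappa).
Proof.
  intros r Hr. do 2 apply ex_series_incr_1. apply (ex_series_ext (fun _ => 0)).
  - intros n. simpl. rewrite Cmod_0. ring.
  - exists 0. apply filterlim_ext with (fun _ => 0); [|apply filterlim_const].
    intros n. rewrite sum_n_const. ring.
Qed.

Lemma ps_linear_factor (kappa z : C) : ps (linear_factor kappa) z = (1 - kappa * z)%C.
Proof.
  assert (Hr := convergent_linear_factor (Cmod z + 1) kappa).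
  assert (Hz : Cmod z < Cmod z + 1) by lra.
  rewrite (ps_unfold _ _ z Hr Hz), (ps_unfold _ _ z (convergent_on_disk_shift _ _ Hr) Hz).
  replace (ps (shift (shift (linear_factor kappa))) z) with (RtoC 0); [unfold shift; simpl; ring|].
  symmetry. apply csum_0. intros n. unfold shift. simpl. ring.
Qed.

Lemma quotient_coeff_linear_factor (kappa : C) (n : nat) (p : nat -> C) :
  (forall k, p (S k) = 0) -> quotient_coeff n p (linear_factor kappa) = (p 0%nat * kappa ^ n)%C.
Proof.
  revert p. induction n as [|n IH]; intros p Hp; [simpl; ring|].
  simpl quotient_coeff. rewrite IH; unfold shift.
  - rewrite Hp. simpl. ring.
  - intros k. rewrite Hp. simpl. ring.
Qed.

(* Its square is [l * (|cis t - cis s|^2 + eps)] for [eps = (1 - l)^2 / l], the regularisation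
   used for the logarithmic energy. *)
Definition circle_kernel (l t s : R) : R := Cmod (1 - l * (cis t * Cconj (cis s))).

Lemma circle_kernel_pos (l t s : R) : 0 <= l < 1 -> 0 < circle_kernel l t s.
Proof.
  intros Hl. apply Cmod_gt_0, one_minus_neq_0.
  rewrite !Cmod_mult, Cmod_conj, !Cmod_cis, Cmod_R, Rabs_pos_eq; lra.
Qed.

Lemma continuous2_circle_kernel (l : R) : continuous2 (circle_kernel l).
Proof. intros p. unfold circle_kernel. solve_continuous. Qed.

Lemma continuous2_ln_circle_kernel (l : R) :
  0 <= l < 1 -> continuous2 (fun t s => ln (circle_kernel l t s)).
Proof.
  intros Hl p.
  apply continuous_ln_comp; [now apply circle_kernel_pos|apply continuous2_circle_kernel].
Qed.

Lemma continuous2_inv_circle_kernel_sqr (l : R) :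
  0 <= l < 1 -> continuous2 (fun t s => / circle_kernel l t s ^ 2).
Proof.
  intros Hl p. apply continuous_inv; [now apply Rgt_not_eq, pow_lt, circle_kernel_pos|].
  apply continuous_pow, continuous2_circle_kernel.
Qed.

Lemma circle_kernel_poisson (l : R) : 0 <= l < 1 ->
  double_integral (fun t s => / circle_kernel l t s ^ 2) = (2 * PI) ^ 2 / (1 - l ^ 2).
Proof.
  intros Hl. assert (L : 1 - l ^ 2 <> 0) by nra.
  transitivity (angle_integral (fun _ => 2 * PI / (1 - l ^ 2))).
  - apply angle_integral_ext. intros s.
    assert (M : Cmod (l * Cconj (cis s)) = l)
      by (rewrite Cmod_mult, Cmod_conj, Cmod_cis, Cmod_R, Rabs_pos_eq; lra).
    replace (1 - l ^ 2) with (1 - Cmod (l * Cconj (cis s)) ^ 2) by now rewrite M.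
    rewrite <- poisson_mean by (rewrite M; lra).
    apply angle_integral_ext. intros t. unfold circle_kernel. do 3 f_equal. ring.
  - rewrite angle_integral_const. field. exact L.
Qed.

Lemma circle_kernel_poisson_le (l : R) : 0 <= l < 1 ->
  (1 - l) ^ 2 * double_integral (fun t s => / circle_kernel l t s ^ 2) <= (2 * PI) ^ 2 * (1 - l).
Proof.
  intros Hl. rewrite circle_kernel_poisson by exact Hl.
  replace ((1 - l) ^ 2 * ((2 * PI) ^ 2 / (1 - l ^ 2)))
    with ((2 * PI) ^ 2 * (1 - l) * / (1 + l))
    by (replace (1 - l ^ 2) with ((1 - l) * (1 + l)) by ring; field; lra).
  rewrite <- (Rmult_1_r ((2 * PI) ^ 2 * (1 - l))) at 2. apply Rmult_le_compat_l.
  - apply Rmult_le_pos; [apply pow2_ge_0|lra].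
  - rewrite <- Rinv_1. apply Rinv_le_contravar; lra.
Qed.

Lemma ln_circle_kernel_fourier (l : R) (c : C) (n : nat) : 0 < l < 1 ->
  INR (S n) * angle_integral (fun t => ln (Cmod (1 - l * cis t)) * Re (c * cis t ^ S n)) =
  - PI * l ^ S n * Re c.
Proof.
  intros Hl. assert (Hr : 0 < 1 < / l).
  { split; [lra|]. rewrite <- Rinv_1. apply Rinv_lt_contravar; lra. }
  assert (Hn : forall z, Cmod z < / l -> ps (linear_factor l) z <> 0).
  { intros z Hz. rewrite ps_linear_factor. apply one_minus_neq_0.
    rewrite Cmod_mult, Cmod_R, Rabs_pos_eq by lra.
    apply (Rmult_lt_compat_l l) in Hz; [|lra]. rewrite Rinv_r in Hz; lra. }
  rewrite (angle_integral_ext _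
    (fun t => ln (Cmod (ps (linear_factor l) (1 * cis t))) * Re (c * cis t ^ S n)))
    by (intros t; now rewrite ps_linear_factor, Cmult_1_l).
  rewrite (ln_ps_fourier (/ l) 1 (linear_factor l) Hr (convergent_linear_factor _ l) eq_refl Hn).
  simpl quotient_coeff.
  rewrite quotient_coeff_linear_factor by (intros k; unfold shift, nmul; simpl; ring).
  rewrite <- (re_conj c).
  replace (Cconj c * 1 ^ S n * _)%C with (RtoC (- l ^ S n) * Cconj c)%C.
  - rewrite Re_scal. ring.
  - rewrite Cpow_1_l, RtoC_opp, RtoC_pow. unfold shift, nmul. simpl. ring.
Qed.

Lemma ln_ratio_le (D e c K : R) : 0 <= D -> 0 < e -> 0 < c -> 1 <= K -> c <= K -> 1 <= K * c ->
  Rabs (ln ((D + c * e) / (D + e))) <= K * (e / (D + e)).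
Proof.
  intros HD He Hc HK HcK HKc.
  assert (B : forall x, 0 < x -> ln x <= x - 1).
  { intros x Hx. generalize (exp_ineq1_le (ln x)). rewrite exp_ln by exact Hx. lra. }
  assert (P : 0 < D + c * e) by nra.
  assert (Q : 0 < / (D + e)) by (apply Rinv_0_lt_compat; lra).
  apply Rabs_le. split.
  - cut (ln ((D + e) / (D + c * e)) <= K * (e / (D + e))).
    { rewrite !ln_div by lra. lra. }
    eapply Rle_trans; [apply B, Rdiv_lt_0_compat; lra|].
    apply Rmult_le_reg_r with ((D + e) * (D + c * e)); [nra|].
    replace (((D + e) / (D + c * e) - 1) * ((D + e) * (D + c * e)))
      with ((1 - c) * e * (D + e)) by (field; lra).
    replace (K * (e / (D + e)) * ((D + e) * (D + c * e))) with (K * e * (D + c * e))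
      by (field; lra).
    assert (U : (1 - c) * (D + e) <= D + e) by nra.
    assert (V : D + e <= K * (D + c * e)) by nra. nra.
  - eapply Rle_trans; [apply B, Rdiv_lt_0_compat; lra|].
    replace ((D + c * e) / (D + e) - 1) with ((c - 1) * (e / (D + e))) by (field; lra).
    apply Rmult_le_compat_r; [|lra]. unfold Rdiv. nra.
Qed.

(** * Charges on the unit circle *)

Definition charge (d : C) (n : nat) (t : R) : C := (cis t + d * Cconj (cis t) ^ n)%C.

Lemma charge_periodic (d : C) (n : nat) (t : R) : charge d n (t + 2 * PI) = charge d n t.
Proof. unfold charge. now rewrite cis_plus, cis_2PI, Cmult_1_r. Qed.

Lemma C_continuous_charge (d : C) (n : nat) (t : R) : C_continuous (charge d n) t.
Proof. unfold charge. solve_continuous. Qed.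

Lemma Cmod_charge_le (d : C) (n : nat) (t : R) : Cmod (charge d n t) <= 1 + Cmod d.
Proof.
  eapply Rle_trans; [apply Cmod_triangle|].
  rewrite Cmod_mult, Cmod_pow, Cmod_conj, Cmod_cis, pow1. lra.
Qed.

Lemma charge_neutral (c d : C) (n : nat) :
  angle_integral (fun t => Re (c * charge d (S n) t)) = 0.
Proof.
  rewrite (angle_integral_ext _ (fun t => Re (c * cis t ^ 1) + Re (c * d * Cconj (cis t) ^ S n))).
  - rewrite angle_integral_plus by (intros t; solve_continuous).
    rewrite angle_integral_cis_pow, angle_integral_conj_cis_pow. ring.
  - intros t. rewrite <- Re_plus. f_equal. unfold charge. simpl. ring.
Qed.

Lemma charge_product (d : C) (n : nat) (theta s : R) :
  Re (charge d n (s + theta) * Cconj (charge d n s)) =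
  Re (cis theta + Cmod d ^ 2 * cis theta ^ n)
    + Re (Cconj d * (cis theta + cis theta ^ n) * cis s ^ S n).
Proof.
  unfold charge. rewrite cis_plus. set (x := cis theta). set (y := cis s).
  assert (Y : (y * Cconj y = 1)%C) by apply cis_mult_conj.
  assert (Yn : (y ^ n * Cconj y ^ n = 1)%C) by now rewrite <- Cpow_mult_l, Y, Cpow_1_l.
  rewrite <- RtoC_pow, Cmod2_conj, !Cplus_conj, !Cmult_conj, Cpow_conj, Cconj_conj, Cpow_mult_l.
  transitivity (Re (x * (y * Cconj y)) + Re (Cconj d * x * y ^ S n)
    + Re (Cconj (Cconj d * x ^ n * y ^ S n))
    + Re (Cconj (d * Cconj d * x ^ n * (y ^ n * Cconj y ^ n)))).
  - rewrite <- !Re_plus. f_equal.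
    rewrite !Cmult_conj, !Cpow_conj, !Cconj_conj. simpl. ring.
  - rewrite !re_conj, Y, Yn, <- !Re_plus. f_equal. ring.
Qed.

Fixpoint horner (l : list C) (x : C) : C :=
  match l with
  | [] => 0
  | c :: l => (c + x * horner l x)%C
  end.

Lemma C_continuous_horner {T : UniformSpace} (l : list C) (f : T -> C) (x : T) :
  C_continuous f x -> C_continuous (fun y => horner l (f y)) x.
Proof.
  intros Hf. induction l as [|c l IH]; simpl; [apply C_continuous_const|]. solve_continuous.
Qed.

Lemma holomorphic_horner (rho : R) (l : list C) : holomorphic rho (horner l).
Proof.
  induction l as [|c l IH]; [exact (holomorphic_const rho 0)|].
  apply (holomorphic_plus rho (fun _ => c) (fun z => z * horner l z)%C); [apply holomorphic_const|].
  apply holomorphic_mult; [apply holomorphic_id|exact IH].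
Qed.

Lemma horner_0 (l : list C) : horner l 0 = nth 0 l (RtoC 0).
Proof. destruct l as [|c l]; [reflexivity|]. simpl. ring. Qed.

Lemma angle_integral_horner (l : list C) (c : C) (n : nat) :
  angle_integral (fun t => Re (c * Cconj (cis t) ^ n * horner l (cis t))) =
  2 * PI * Re (c * nth n l (RtoC 0)).
Proof.
  revert l. induction n as [|n IH]; intros l.
  - rewrite <- horner_0. rewrite <- (circle_mean_holomorphic 2 1 (fun z => c * horner l z)%C).
    + apply angle_integral_ext. intros t. rewrite Cmult_1_l. f_equal. simpl. ring.
    + apply holomorphic_mult; [apply holomorphic_const|apply holomorphic_horner].
    + lra.
  - destruct l as [|e l].
    + rewrite (angle_integral_ext _ (fun _ => 0))
        by (intros t; simpl horner; rewrite Cmult_0_r; reflexivity).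
      rewrite angle_integral_const. simpl nth. rewrite Cmult_0_r. simpl. ring.
    + simpl nth. symmetry. rewrite <- IH, <- (Rplus_0_l (angle_integral _)).
      rewrite <- (angle_integral_conj_cis_pow (c * e) n), <- angle_integral_plus.
      * apply angle_integral_ext. intros t. rewrite <- Re_plus. f_equal. simpl horner.
        transitivity (c * e * Cconj (cis t) ^ S n
          + c * Cconj (cis t) ^ n * horner l (cis t) * (cis t * Cconj (cis t)))%C; [|simpl; ring].
        rewrite cis_mult_conj. ring.
      * intros t. solve_continuous.
      * intros t. assert (Ch := C_continuous_horner l cis t (cis_continuous t)).
        solve_continuous.
Qed.

Lemma charge_energy_circle_kernel (l : R) (d : C) (n : nat) : 0 < l < 1 ->
  INR (S n) * double_integral (fun t s =>
    ln (circle_kernel l t s) * Re (charge d (S n) t * Cconj (charge d (S n) s))) =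
  - (2 * PI ^ 2) * (INR (S n) * l + Cmod d ^ 2 * l ^ S n).
Proof.
  intros Hl. set (U := charge d (S n)).
  assert (CU : forall t, C_continuous U t) by apply C_continuous_charge.
  assert (Cf : continuous2 (fun t s => ln (circle_kernel l t s) * Re (U t * Cconj (U s)))).
  { assert (Cln := continuous2_ln_circle_kernel l ltac:(lra)). solve_continuous2. }
  assert (Cl : forall t, continuous (fun t => ln (Cmod (1 - l * cis t))) t).
  { intros t. apply continuous_ln_comp; [|solve_continuous].
    apply Cmod_gt_0, one_minus_neq_0. rewrite Cmod_circle; lra. }
  rewrite double_integral_shear; [|exact Cf|].
  2:{ intros t s. unfold U, circle_kernel.
      now rewrite charge_periodic, cis_plus, cis_2PI, Cmult_1_r. }
  rewrite (angle_integral_ext _ (fun theta => 2 * PI * (ln (Cmod (1 - l * cis theta)) *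
    Re (1 * cis theta ^ 1) + ln (Cmod (1 - l * cis theta)) * Re (Cmod d ^ 2 * cis theta ^ S n)))).
  - rewrite angle_integral_scal, angle_integral_plus by (intros t; solve_continuous).
    assert (F1 := ln_circle_kernel_fourier l 1 0 Hl).
    assert (Fn := ln_circle_kernel_fourier l (Cmod d ^ 2) n Hl).
    change (INR 1) with 1 in F1. rewrite Rmult_1_l in F1. rewrite F1.
    transitivity (2 * PI *
      (INR (S n) * (- PI * l ^ 1 * Re 1) + (- PI * l ^ S n * Re (Cmod d ^ 2)))).
    + rewrite <- Fn. ring.
    + rewrite <- RtoC_pow. unfold Re. simpl. ring.
  - intros theta. set (k := ln (Cmod (1 - l * cis theta))).
    set (c := (Cconj d * (cis theta + cis theta ^ S n))%C).
    rewrite (angle_integral_ext _ (fun s => k * Re (cis theta + Cmod d ^ 2 * cis theta ^ S n)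
      + k * Re (c * cis s ^ S (S n)))).
    + rewrite angle_integral_plus, angle_integral_const, angle_integral_scal by
        (intros s; solve_continuous).
      rewrite angle_integral_cis_pow, Re_plus, Cmult_1_l, Cpow_1_r. ring.
    + intros s. unfold U. rewrite charge_product. fold c. unfold k, circle_kernel.
      rewrite (Rplus_comm s), cis_plus, <- Cmult_assoc, cis_mult_conj, Cmult_1_r. ring.
Qed.

(** * Univalent power series *)

Lemma C_continuous_diff_quotient {T : UniformSpace} (rho r : R) (a : nat -> C)
  (f g : T -> C) (x : T) :
  convergent_on_disk rho a -> 0 <= r < rho ->
  (forall y, Cmod (f y) <= r) -> (forall y, Cmod (g y) <= r) ->
  C_continuous f x -> C_continuous g x -> C_continuous (fun y => diff_quotient a (f y) (g y)) x.
Proof.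
  intros Ha Hr Bf Bg Hf Hg.
  destruct (diff_quotient_lipschitz rho a Ha r Hr) as (L & HL & Lip).
  apply filterlim_locally. intros eps.
  assert (He : 0 < eps / (2 * (L + 1))) by (apply Rdiv_lt_0_compat; [apply cond_pos|lra]).
  assert (Ef := proj1 (filterlim_locally _ _) Hf (mkposreal _ He)).
  assert (Eg := proj1 (filterlim_locally _ _) Hg (mkposreal _ He)).
  generalize (filter_and _ _ Ef Eg). apply filter_imp. intros y [Nf Ng].
  change (Cmod (f y - f x) < eps / (2 * (L + 1))) in Nf.
  change (Cmod (g y - g x) < eps / (2 * (L + 1))) in Ng.
  change (Cmod (diff_quotient a (f y) (g y) - diff_quotient a (f x) (g x)) < eps).
  assert (L1 := Lip (f y) (f x) (g y) (Bf y) (Bf x) (Bg y)).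
  assert (L2 := Lip (g y) (g x) (f x) (Bg y) (Bg x) (Bf x)).
  rewrite !(diff_quotient_sym a _ (f x)) in L2.
  replace (diff_quotient a (f y) (g y) - diff_quotient a (f x) (g x))%C with
    ((diff_quotient a (f y) (g y) - diff_quotient a (f x) (g y))
      + (diff_quotient a (f x) (g y) - diff_quotient a (f x) (g x)))%C by ring.
  eapply Rle_lt_trans; [apply Cmod_triangle|].
  assert (E : eps / (2 * (L + 1)) * (2 * (L + 1)) = eps) by (field; lra).
  assert (P1 := Cmod_ge_0 (f y - f x)). assert (P2 := Cmod_ge_0 (g y - g x)). nra.
Qed.

Section univalent.
Variables (rho : R) (a : nat -> C).
Hypothesis Hrho : 1 < rho.
Hypothesis Ha : convergent_on_disk rho a.
Hypothesis a1 : a 1%nat = 1.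
Hypothesis Inj : forall z w, Cmod z < rho -> Cmod w < rho -> ps a z = ps a w -> z = w.

Definition rotated_quotient (x : C) (k : nat) : C := (a (S k) * power_quotient k x 1)%C.

Lemma ps_rotated_quotient (theta : R) (z : C) :
  ps (rotated_quotient (cis theta)) z = diff_quotient a (cis theta * z) z.
Proof. symmetry. apply diff_quotient_scal. Qed.

Lemma convergent_rotated_quotient (theta : R) :
  convergent_on_disk rho (rotated_quotient (cis theta)).
Proof. apply convergent_on_disk_diff_quotient; [exact Ha|]. rewrite Cmod_cis. lra. Qed.

Lemma rotated_quotient_0 (x : C) : rotated_quotient x 0 = 1.
Proof. unfold rotated_quotient. rewrite a1. simpl. ring. Qed.

Lemma rotated_quotient_neq_0 (theta : R) (z : C) : cis theta <> 1 -> Cmod z < rho ->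
  ps (rotated_quotient (cis theta)) z <> 0.
Proof.
  intros Hx Hz E. destruct (Ceq_dec z 0) as [->|Hz0].
  - rewrite (ps_at_0 rho), rotated_quotient_0 in E by (lra || apply convergent_rotated_quotient).
    injection E. lra.
  - assert (Hxz : Cmod (cis theta * z) < rho) by (rewrite Cmod_mult, Cmod_cis; lra).
    rewrite ps_rotated_quotient in E.
    assert (S := diff_quotient_spec rho a Ha _ _ Hxz Hz). rewrite E, Cmult_0_r in S.
    assert (F : (cis theta * z)%C = z).
    { apply Inj; auto. transitivity (ps a (cis theta * z) - ps a z + ps a z)%C; [ring|].
      rewrite <- S. ring. }
    apply Hx. transitivity (cis theta * z / z)%C; [field; exact Hz0|]. rewrite F. field. exact Hz0.
Qed.

(* For [x = cis theta <> 1] the quotient has no zeros because the series is injective. The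
   lower bound given by Harnack's inequality is uniform in [x], so it passes to the limit
   [x -> 1]; in particular the derivative has no zeros. *)
Lemma rotated_quotient_lower_bound (r : R) : 0 <= r < rho ->
  exists m, 0 < m /\ forall theta z, Cmod z <= r -> m <= Cmod (diff_quotient a (cis theta * z) z).
Proof.
  intros Hr. set (s := (r + rho) / 2). assert (Hs : r < s < rho) by (unfold s; lra).
  destruct (diff_quotient_bound rho a Ha s ltac:(lra)) as [M HM].
  destruct (zero_free_lower_bound s r (Rmax 1 M)) as (m & Hm & Low); [lra|apply Rmax_l|].
  exists m. split; [exact Hm|].
  assert (Off : forall theta z, cis theta <> 1 -> Cmod z <= r ->
    m <= Cmod (diff_quotient a (cis theta * z) z)).
  { intros theta z Hx Hz. rewrite <- ps_rotated_quotient.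
    apply (Low _ (ps (deriv_seq (rotated_quotient (cis theta))))); auto.
    - intros w Hw. apply is_C_derive_ps with rho; [apply convergent_rotated_quotient|lra].
    - apply holomorphic_ps, convergent_on_disk_deriv.
      intros t Ht. apply convergent_rotated_quotient. lra.
    - intros w Hw. split; [apply rotated_quotient_neq_0; auto; lra|].
      rewrite ps_rotated_quotient. eapply Rle_trans; [|apply Rmax_r].
      apply HM; rewrite ?Cmod_mult, ?Cmod_cis; lra.
    - rewrite (ps_at_0 rho) by (lra || apply convergent_rotated_quotient).
      apply rotated_quotient_0. }
  intros theta z Hz. destruct (Ceq_dec (cis theta) 1) as [E|E]; [|now apply Off].
  apply Rnot_lt_le. intros Lt.
  assert (C0 : continuous (fun t => Cmod (diff_quotient a (cis t * z) z)) 0).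
  { apply continuous_Cmod, (C_continuous_diff_quotient rho r); auto; try solve_continuous.
    intros y. rewrite Cmod_mult, Cmod_cis. lra. }
  assert (Near := C0 (fun y => y < m)). cbv beta in Near. rewrite E, <- cis_0 in Lt.
  destruct (Near (open_lt m _ Lt)) as [d Hd]. assert (Hdp := cond_pos d). assert (Hpi := PI2_1).
  set (t := Rmin (d / 2) 1).
  assert (Ht : 0 < t <= d / 2 /\ t <= 1).
  { split; [split; [apply Rmin_glb_lt; lra|apply Rmin_l]|apply Rmin_r]. }
  specialize (Hd t). assert (Bad := Off t z (cis_neq_1 t ltac:(lra)) Hz).
  cut (Cmod (diff_quotient a (cis t * z) z) < m); [lra|]. apply Hd.
  change (Rabs (t - 0) < d). rewrite Rminus_0_r, Rabs_pos_eq; lra.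
Qed.

Definition log_quotient (t s : R) : R := ln (Cmod (diff_quotient a (cis t) (cis s))).

Lemma continuous_circle_quotient (p : R * R) :
  C_continuous (fun p : R * R => diff_quotient a (cis (fst p)) (cis (snd p))) p.
Proof.
  apply (C_continuous_diff_quotient rho 1); try solve_continuous; try lra;
    intros y; rewrite Cmod_cis; lra.
Qed.

Lemma circle_quotient_bounds : exists K, 1 <= K /\ forall t s,
  0 < Cmod (diff_quotient a (cis t) (cis s)) /\
  / Cmod (diff_quotient a (cis t) (cis s)) ^ 2 <= K /\
  Cmod (diff_quotient a (cis t) (cis s)) ^ 2 <= K.
Proof.
  destruct (rotated_quotient_lower_bound 1) as (m & Hm & Low); [lra|].
  destruct (diff_quotient_bound rho a Ha 1) as [M HM]; [lra|].
  assert (Hm2 : 0 < / m ^ 2) by (apply Rinv_0_lt_compat, pow_lt; exact Hm).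
  exists (1 + M ^ 2 + / m ^ 2). assert (HM2 := pow2_ge_0 M). split; [lra|]. intros t s.
  assert (G := Low (t - s) (cis s)). rewrite <- cis_plus in G.
  replace (t - s + s) with t in G by ring. rewrite Cmod_cis in G. specialize (G ltac:(lra)).
  assert (U := HM (cis t) (cis s)). rewrite !Cmod_cis in U. specialize (U ltac:(lra) ltac:(lra)).
  set (g := Cmod _) in *. split; [lra|split].
  - cut (/ g ^ 2 <= / m ^ 2); [lra|]. apply Rinv_le_contravar; [now apply pow_lt|].
    apply pow_incr. lra.
  - assert (g ^ 2 <= M ^ 2) by (apply pow_incr; lra). lra.
Qed.

Lemma continuous2_log_quotient : continuous2 log_quotient.
Proof.
  intros p. destruct circle_quotient_bounds as (K & _ & HK).
  apply continuous_ln_comp; [apply HK|]. apply continuous_Cmod, continuous_circle_quotient.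
Qed.

Lemma log_distance_comparison : exists K, 0 <= K /\ forall l t s, 0 < l < 1 ->
  Rabs (ln (Cmod (ps a (cis t) - ps a (cis s)) ^ 2 + (1 - l) ^ 2 / l)
    - (2 * ln (circle_kernel l t s) - ln l + 2 * log_quotient t s))
  <= K * (1 - l) ^ 2 * / circle_kernel l t s ^ 2.
Proof.
  destruct circle_quotient_bounds as (K & HK1 & HK). exists K. split; [lra|]. intros l t s Hl.
  destruct (HK t s) as (Hg & HgK & HKg). unfold log_quotient.
  rewrite <- (diff_quotient_spec rho a Ha) by (rewrite Cmod_cis; lra). rewrite Cmod_mult.
  set (g := Cmod (diff_quotient a (cis t) (cis s))) in *.
  set (D := Cmod (cis t - cis s) ^ 2). set (e := (1 - l) ^ 2 / l).
  assert (HD : 0 <= D) by apply pow2_ge_0.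
  assert (He : 0 < e) by (apply Rdiv_lt_0_compat; [apply pow_lt|]; lra).
  assert (Hk := circle_kernel_pos l t s ltac:(lra)).
  assert (EN : circle_kernel l t s ^ 2 = l * (D + e))
    by (apply Cmod2_one_minus; rewrite ?Cmod_cis; lra).
  set (N := circle_kernel l t s) in *.
  assert (Hg2 : 0 < g ^ 2) by now apply pow_lt.
  assert (LN : 2 * ln N - ln l = ln (D + e)).
  { replace (D + e) with (N ^ 2 / l) by (rewrite EN; field; lra).
    rewrite ln_div by (try apply pow_lt; lra). rewrite ln_pow by exact Hk. simpl INR. ring. }
  assert (LG : ln ((Cmod (cis t - cis s) * g) ^ 2 + e) = 2 * ln g + ln (D + / g ^ 2 * e)).
  { replace ((Cmod (cis t - cis s) * g) ^ 2 + e) with (g ^ 2 * (D + / g ^ 2 * e))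
      by (unfold D; field; lra).
    rewrite ln_mult, ln_pow; [simpl INR; ring|exact Hg|exact Hg2|].
    assert (0 < / g ^ 2) by now apply Rinv_0_lt_compat. nra. }
  assert (B := ln_ratio_le D e (/ g ^ 2) K HD He ltac:(now apply Rinv_0_lt_compat) HK1 HgK).
  rewrite ln_div in B by (assert (0 < / g ^ 2) by (now apply Rinv_0_lt_compat); nra).
  rewrite LN, LG. replace (K * (1 - l) ^ 2 * / N ^ 2) with (K * (e / (D + e))).
  - replace (2 * ln g + ln (D + / g ^ 2 * e) - (ln (D + e) + 2 * ln g))
      with (ln (D + / g ^ 2 * e) - ln (D + e)) by ring.
    apply B. apply Rmult_le_reg_r with (g ^ 2); [exact Hg2|].
    rewrite Rmult_assoc, Rinv_l; lra.
  - assert (Le : l * e = (1 - l) ^ 2) by (unfold e; field; lra).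
    rewrite EN, <- Le. field. lra.
Qed.

Lemma continuous_boundary_curve (t : R) : C_continuous (fun t => ps a (cis t)) t.
Proof.
  apply (continuous_comp (V := C_Uniform) (W := C_Uniform) cis (ps a)); [apply cis_continuous|].
  apply holomorphic_continuous with rho; [now apply holomorphic_ps|]. rewrite Cmod_cis. lra.
Qed.

Lemma grunsky_energy_real (u : R -> R) (B : R) :
  (forall t, continuous u t) -> (forall t, Rabs (u t) <= B) -> angle_integral u = 0 ->
  exists K, forall l, 0 < l < 1 ->
    double_integral (fun t s => log_quotient t s * (u t * u s)) <=
    - double_integral (fun t s => ln (circle_kernel l t s) * (u t * u s)) + K * (1 - l).
Proof.
  intros Cu HB Hu. destruct log_distance_comparison as (K & HK0 & HK).
  destruct (ps_bound rho 1 a Ha) as [A HA]; [lra|].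
  exists (K * B ^ 2 * (2 * PI) ^ 2 / 2). intros l Hl.
  set (gamma := fun t => ps a (cis t)). set (e := (1 - l) ^ 2 / l).
  assert (He : 0 < e) by (apply Rdiv_lt_0_compat; [apply pow_lt|]; lra).
  assert (Cg : forall t, C_continuous gamma t) by apply continuous_boundary_curve.
  assert (Neg := log_energy_nonpos gamma u e A B Cg
    ltac:(intros t; apply HA; rewrite Cmod_cis; lra) Cu HB Hu He).
  set (N := fun t s => / circle_kernel l t s ^ 2).
  set (k := fun t s => ln (Cmod (gamma t - gamma s) ^ 2 + e)).
  change (double_integral (fun t s => k t s * (u t * u s)) <= 0) in Neg.
  assert (CN : continuous2 N) by (apply continuous2_inv_circle_kernel_sqr; lra).
  assert (Ck : continuous2 k).
  { intros p. apply continuous_ln_comp; [|solve_continuous].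
    generalize (pow2_ge_0 (Cmod (gamma (fst p) - gamma (snd p)))). lra. }
  assert (CL := continuous2_log_quotient).
  assert (Cc := continuous2_ln_circle_kernel l ltac:(lra)).
  assert (I : double_integral (fun t s => 2 * (log_quotient t s * (u t * u s)) +
      (2 * (ln (circle_kernel l t s) * (u t * u s)) + - ln l * (u t * u s)))
    <= double_integral (fun t s => k t s * (u t * u s) + K * (1 - l) ^ 2 * B ^ 2 * N t s)).
  { apply double_integral_le; [solve_continuous2..|]. intros t s.
    assert (U : Rabs (u t * u s) <= B * B)
      by (rewrite Rabs_mult; apply Rmult_le_compat; auto using Rabs_pos).
    assert (V := Rmult_le_compat _ _ _ _ (Rabs_pos _) (Rabs_pos _) (HK l t s Hl) U).
    rewrite <- Rabs_mult in V. apply Rabs_le_between in V. unfold k, N, gamma, e. lra. }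
  rewrite !double_integral_plus, !double_integral_scal in I by solve_continuous2.
  rewrite double_integral_product, Hu in I by exact Cu.
  assert (F := circle_kernel_poisson_le l ltac:(lra)). fold N in F.
  assert (KB : 0 <= K * B ^ 2) by (apply Rmult_le_pos; [exact HK0|apply pow2_ge_0]).
  apply (Rmult_le_compat_l _ _ _ KB) in F. lra.
Qed.

Lemma grunsky_energy (U : R -> C) (B : R) :
  (forall t, C_continuous U t) -> (forall t, Cmod (U t) <= B) ->
  (forall c, angle_integral (fun t => Re (c * U t)) = 0) ->
  exists K, forall l, 0 < l < 1 ->
    double_integral (fun t s => log_quotient t s * Re (U t * Cconj (U s))) <=
    - double_integral (fun t s => ln (circle_kernel l t s) * Re (U t * Cconj (U s))) + K * (1 - l).
Proof.
  intros CU HB HU.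
  destruct (grunsky_energy_real (fun t => Re (U t)) B) as [KRe ERe].
  { intros t. solve_continuous. }
  { intros t. eapply Rle_trans; [apply re_le_Cmod|apply HB]. }
  { rewrite <- (HU 1). apply angle_integral_ext. intros t. now rewrite Cmult_1_l. }
  destruct (grunsky_energy_real (fun t => Im (U t)) B) as [KIm EIm].
  { intros t. solve_continuous. }
  { intros t. eapply Rle_trans; [apply Rabs_Im_le_Cmod|apply HB]. }
  { rewrite <- (HU (- Ci)%C). apply angle_integral_ext. intros t. unfold Re, Im. simpl. ring. }
  assert (Split : forall k : R -> R -> R, continuous2 k ->
    double_integral (fun t s => k t s * Re (U t * Cconj (U s))) =
    double_integral (fun t s => k t s * (Re (U t) * Re (U s)))
    + double_integral (fun t s => k t s * (Im (U t) * Im (U s)))).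
  { intros k Ck. rewrite <- double_integral_plus by solve_continuous2.
    apply double_integral_ext. intros t s. unfold Re, Im. simpl. ring. }
  exists (KRe + KIm). intros l Hl. specialize (ERe l Hl). specialize (EIm l Hl).
  rewrite !Split; [lra| |apply continuous2_log_quotient].
  apply continuous2_ln_circle_kernel. lra.
Qed.

Lemma log_quotient_periodic (t s : R) : log_quotient (t + 2 * PI) s = log_quotient t s.
Proof. unfold log_quotient. now rewrite cis_plus, cis_2PI, Cmult_1_r. Qed.

Lemma log_quotient_shear (theta s : R) :
  log_quotient (s + theta) s = ln (Cmod (ps (rotated_quotient (cis theta)) (1 * cis s))).
Proof.
  unfold log_quotient. now rewrite ps_rotated_quotient, Cmult_1_l, Rplus_comm, cis_plus.
Qed.

Lemma ps_rotated_quotient_neq_0 (theta : R) (z : C) : Cmod z < rho ->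
  ps (rotated_quotient (cis theta)) z <> 0.
Proof.
  intros Hz. destruct (rotated_quotient_lower_bound (Cmod z)) as (m & Hm & Low).
  { split; [apply Cmod_ge_0|exact Hz]. }
  apply Cmod_gt_0. rewrite ps_rotated_quotient. generalize (Low theta z (Rle_refl _)). lra.
Qed.

Definition rotated_log_coeff (n : nat) (theta : R) : C :=
  quotient_coeff n (nmul (rotated_quotient (cis theta))) (rotated_quotient (cis theta)).

Lemma charge_energy_log_quotient (d : C) (n : nat) :
  INR (S n) * double_integral (fun t s =>
    log_quotient t s * Re (charge d n t * Cconj (charge d n s)))
  = angle_integral (fun theta =>
      PI * Re (d * (Cconj (cis theta) + Cconj (cis theta) ^ n) * rotated_log_coeff (S n) theta)).
Proof.
  assert (Cc := C_continuous_charge d n).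
  assert (Cf : continuous2 (fun t s =>
    log_quotient t s * Re (charge d n t * Cconj (charge d n s)))).
  { assert (CL := continuous2_log_quotient). solve_continuous2. }
  rewrite double_integral_shear; [|exact Cf|].
  2:{ intros t s. now rewrite log_quotient_periodic, charge_periodic. }
  rewrite <- angle_integral_scal by
    (intros theta; now apply (continuous2_inner _ theta), (continuous2_shear _ Cf)).
  apply angle_integral_ext. intros theta. set (x := cis theta).
  set (b := rotated_quotient x). set (c := (Cconj d * (x + x ^ n))%C).
  assert (Hb : convergent_on_disk rho b) by apply convergent_rotated_quotient.
  assert (Hb0 : b 0%nat = 1) by apply rotated_quotient_0.
  assert (Hbn := ps_rotated_quotient_neq_0 theta). fold x b in Hbn.
  assert (Hr : 0 < 1 < rho) by lra.
  assert (Cl : forall s, continuous (fun s => ln (Cmod (ps b (1 * cis s)))) s).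
  { intros s. apply (continuous_on_circle rho (fun z => ln (Cmod (ps b z))) _
      (has_gradient_ln_ps rho b Hb Hbn)). lra. }
  rewrite (angle_integral_ext _ (fun s => Re (x + Cmod d ^ 2 * x ^ n) * ln (Cmod (ps b (1 * cis s)))
    + ln (Cmod (ps b (1 * cis s))) * Re (c * cis s ^ S n))).
  - rewrite angle_integral_plus, angle_integral_scal by (intros s; solve_continuous).
    rewrite (ln_ps_mean rho 1 b Hr Hb Hb0 Hbn), Rmult_0_r, Rplus_0_l.
    rewrite (ln_ps_fourier rho 1 b Hr Hb Hb0 Hbn). do 2 f_equal.
    unfold c. rewrite Cmult_conj, Cplus_conj, Cpow_conj, Cconj_conj, Cpow_1_l.
    unfold rotated_log_coeff. fold x b. ring.
  - intros s. rewrite log_quotient_shear, charge_product. fold x b c. ring.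
Qed.

Section grunsky_coefficient.
(* [gamma] is the coefficient of [z w^(n+1)] and of [z^(n+1) w] in the logarithm of the
   difference quotient. *)
Variables (n : nat) (l : list C) (gamma : C).
Hypothesis log_coeff_horner :
  forall theta, rotated_log_coeff (S (S n)) theta = horner l (cis theta).
Hypothesis nth_1 : nth 1 l (RtoC 0) = (INR (S (S n)) * gamma)%C.
Hypothesis nth_S_n : nth (S n) l (RtoC 0) = (INR (S (S n)) * gamma)%C.

Lemma grunsky_inequality (d : C) : INR (S n) * (2 * Re (d * gamma)) <= INR (S n) + Cmod d ^ 2.
Proof.
  assert (Hpi := PI_RGT_0). assert (N := lt_0_INR (S n) ltac:(lia)).
  assert (E : double_integral (fun t s =>
    log_quotient t s * Re (charge d (S n) t * Cconj (charge d (S n) s)))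
    = 4 * PI ^ 2 * Re (d * gamma)).
  { apply Rmult_eq_reg_l with (INR (S (S n))); [|now apply not_0_INR].
    rewrite charge_energy_log_quotient.
    rewrite (angle_integral_ext _ (fun theta =>
      PI * (Re (d * Cconj (cis theta) ^ 1 * horner l (cis theta))
        + Re (d * Cconj (cis theta) ^ S n * horner l (cis theta))))).
    - assert (Ch : forall t, C_continuous (fun t => horner l (cis t)) t)
        by (intros t; apply C_continuous_horner; solve_continuous).
      rewrite angle_integral_scal, angle_integral_plus, !angle_integral_horner, nth_1, nth_S_n by
        (intros t; solve_continuous).
      replace (d * (INR (S (S n)) * gamma))%C with (INR (S (S n)) * (d * gamma))%C by ring.
      rewrite Re_scal. ring.
    - intros theta. rewrite log_coeff_horner, <- Re_plus. do 2 f_equal. rewrite Cpow_1_r. ring. }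
  destruct (grunsky_energy (charge d (S n)) (1 + Cmod d)) as [K HK].
  { apply C_continuous_charge. }
  { apply Cmod_charge_le. }
  { intros c. apply charge_neutral. }
  cut (2 * PI ^ 2 * (INR (S n) * (2 * Re (d * gamma))) <= 2 * PI ^ 2 * (INR (S n) + Cmod d ^ 2)).
  { apply Rmult_le_reg_l. apply Rmult_lt_0_compat; [lra|now apply pow_lt]. }
  apply (le_of_vanishing_error _ _ (INR (S n) * K)). intros r Hr.
  specialize (HK r Hr). rewrite E in HK. apply (Rmult_le_compat_l (INR (S n))) in HK; [|lra].
  assert (Ec := charge_energy_circle_kernel r d n Hr).
  assert (P1 : INR (S n) * r <= INR (S n)) by nra.
  assert (P2 : Cmod d ^ 2 * r ^ S n <= Cmod d ^ 2).
  { rewrite <- (Rmult_1_r (Cmod d ^ 2)) at 2. apply Rmult_le_compat_l; [apply pow2_ge_0|].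
    rewrite <- (pow1 (S n)). apply pow_incr. lra. }
  assert (P3 := Rmult_le_compat_l (2 * PI ^ 2) _ _ ltac:(generalize (pow2_ge_0 PI); lra)
    (Rplus_le_compat _ _ _ _ P1 P2)).
  lra.
Qed.

Lemma grunsky_coefficient_bound : INR (S n) * Cmod gamma ^ 2 <= 1.
Proof.
  assert (N := lt_0_INR (S n) ltac:(lia)).
  assert (G := grunsky_inequality (INR (S n) * Cconj gamma)).
  rewrite <- Cmult_assoc, (Cmult_comm (Cconj gamma)), <- Cmod2_conj, Re_scal in G.
  rewrite Cmod_mult, Cmod_conj, Cmod_R, Rabs_pos_eq in G by lra.
  change (Re (RtoC (Cmod gamma ^ 2))) with (Cmod gamma ^ 2) in G.
  apply Rmult_le_reg_l with (INR (S n)); [exact N|].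
  replace ((INR (S n) * Cmod gamma) ^ 2)
    with (INR (S n) * (INR (S n) * Cmod gamma ^ 2)) in G by ring.
  lra.
Qed.

End grunsky_coefficient.

Hypothesis a2 : a 2%nat = 0.

Lemma rotated_quotient_1 (x : C) : rotated_quotient x 1 = 0.
Proof. unfold rotated_quotient. rewrite a2. ring. Qed.

Theorem univalent_coefficient_bounds :
  Cmod (a 3%nat) ^ 2 <= 1 /\ 2 * Cmod (a 4%nat) ^ 2 <= 1 /\
  3 * Cmod (a 5%nat - a 3%nat * a 3%nat) ^ 2 <= 1.
Proof.
  split; [|split].
  - rewrite <- (Rmult_1_l (_ ^ 2)).
    apply (grunsky_coefficient_bound 0 [2 * a 3%nat; 2 * a 3%nat; 2 * a 3%nat]%C);
      [|rewrite INR_IZR_INZ; simpl; ring..].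
    intros theta. unfold rotated_log_coeff. rewrite quotient_coeff_nmul_2, rotated_quotient_1.
    unfold rotated_quotient. simpl. ring.
  - replace 2 with (INR 2) by (simpl; ring).
    apply (grunsky_coefficient_bound 1 [3 * a 4%nat; 3 * a 4%nat; 3 * a 4%nat; 3 * a 4%nat]%C);
      [|rewrite INR_IZR_INZ; simpl; ring..].
    intros theta. unfold rotated_log_coeff. rewrite quotient_coeff_nmul_3, rotated_quotient_1.
    unfold rotated_quotient. simpl. ring.
  - replace 3 with (INR 3) by (simpl; ring). set (c := (a 3%nat * a 3%nat)%C).
    apply (grunsky_coefficient_bound 2
      [4 * a 5%nat - 2 * c; 4 * a 5%nat - 4 * c; 4 * a 5%nat - 6 * c;
       4 * a 5%nat - 4 * c; 4 * a 5%nat - 2 * c]%C);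
      [|rewrite INR_IZR_INZ; simpl; ring..].
    intros theta. unfold rotated_log_coeff. rewrite quotient_coeff_nmul_4, rotated_quotient_1.
    unfold rotated_quotient, c. simpl. ring.
Qed.

End univalent.

(** * The coefficients of the inverse function *)

Lemma vanishing_cofactor (r : R) (h : C -> C) : 0 < r -> CC_continuous h (RtoC 0) ->
  (forall w : C, Cmod w < r -> (w * h w)%C = 0) ->
  h 0 = 0 /\ forall w : C, Cmod w < r -> h w = 0.
Proof.
  intros Hr Ch H.
  assert (Off : forall w : C, w <> 0 -> Cmod w < r -> h w = 0).
  { intros w Hw0 Hw. transitivity (w * h w / w)%C; [field; exact Hw0|].
    rewrite H by exact Hw. field. exact Hw0. }
  assert (At0 : h 0 = 0).
  { apply Cmod_eq_0, Rle_antisym; [|apply Cmod_ge_0]. apply Rnot_lt_le. intros L.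
    destruct (proj1 (filterlim_locally _ _) Ch (mkposreal _ L)) as [d Hd].
    assert (Hdp := cond_pos d). set (t := Rmin (d / 2) (r / 2)).
    assert (T1 := Rmin_l (d / 2) (r / 2)). assert (T2 := Rmin_r (d / 2) (r / 2)).
    assert (Ht : 0 < t) by (apply Rmin_glb_lt; lra). fold t in T1, T2.
    assert (Mt : Cmod t = t) by (rewrite Cmod_R, Rabs_pos_eq; lra).
    assert (B : Cmod (h t - h 0) < Cmod (h 0)).
    { apply (Hd (RtoC t)). change (Cmod (t - 0) < d).
      replace (t - 0)%C with (RtoC t) by ring. lra. }
    rewrite (Off t) in B; [|intros E; injection E; lra|lra].
    replace (0 - h 0)%C with (- h 0)%C in B by ring. rewrite Cmod_opp in B. lra. }
  split; [exact At0|]. intros w Hw. destruct (Ceq_dec w 0) as [->|Hw0]; [exact At0|now apply Off].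
Qed.

Lemma iter_shift (k n : nat) (b : nat -> C) : Nat.iter k shift b n = b (k + n)%nat.
Proof.
  revert n. induction k as [|k IH]; intros n; [reflexivity|].
  simpl. unfold shift at 1. rewrite IH. f_equal. lia.
Qed.

Lemma convergent_iter_shift (rho : R) (k : nat) (b : nat -> C) :
  convergent_on_disk rho b -> convergent_on_disk rho (Nat.iter k shift b).
Proof. intros Hb. induction k as [|k IH]; [exact Hb|]. now apply convergent_on_disk_shift. Qed.

Section inverse_expansion.
Variables (r : R) (a A : nat -> C).
Hypothesis Hr : 0 < r.
Hypothesis Ha : convergent_on_disk 1 a.
Hypothesis HA : convergent_on_disk r A.
Hypothesis a0 : a 0%nat = 0.
Hypothesis a1 : a 1%nat = 1.
Hypothesis a2 : a 2%nat = 0.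
Hypothesis A0 : A 0%nat = 0.
Hypothesis Hinv : forall w : C, Cmod w < r -> Cmod (ps A w) < 1 /\ ps a (ps A w) = w.

Let g (k : nat) (w : C) : C := ps (Nat.iter k shift A) w.

Let f (k : nat) (w : C) : C := ps (Nat.iter k shift a) (ps A w).

Lemma inverse_tail_unfold (k : nat) (w : C) : Cmod w < r -> g k w = (A k + w * g (S k) w)%C.
Proof.
  intros Hw. unfold g. rewrite (ps_unfold r) by auto using convergent_iter_shift.
  now rewrite iter_shift, Nat.add_0_r.
Qed.

Lemma series_tail_unfold (k : nat) (w : C) : Cmod w < r -> f k w = (a k + w * g 1 w * f (S k) w)%C.
Proof.
  intros Hw. destruct (Hinv w Hw) as [Hg _]. unfold f.
  rewrite (ps_unfold 1) by auto using convergent_iter_shift.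
  rewrite iter_shift, Nat.add_0_r. do 2 f_equal.
  change (ps A w) with (g 0 w). rewrite inverse_tail_unfold, A0 by exact Hw. ring.
Qed.

Lemma inverse_tail_continuous (k : nat) : CC_continuous (g k) (RtoC 0).
Proof.
  apply holomorphic_continuous with r; [|now rewrite Cmod_0].
  now apply holomorphic_ps, convergent_iter_shift.
Qed.

Lemma series_tail_continuous (k : nat) : CC_continuous (f k) (RtoC 0).
Proof.
  apply (continuous_comp (U := C_Uniform) (V := C_Uniform) (W := C_Uniform) (ps A)
    (ps (Nat.iter k shift a))); [apply (inverse_tail_continuous 0)|].
  apply holomorphic_continuous with 1; [|apply Hinv; now rewrite Cmod_0].
  now apply holomorphic_ps, convergent_iter_shift.
Qed.

Lemma inverse_tail_at_0 (k : nat) : g k 0 = A k.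
Proof. rewrite inverse_tail_unfold by now rewrite Cmod_0. ring. Qed.

Lemma series_tail_at_0 (k : nat) : f k 0 = a k.
Proof. rewrite series_tail_unfold by now rewrite Cmod_0. ring. Qed.

(* The equation [ps a (ps A w) = w], divided by one more power of [w] at each stage. *)
Lemma inverse_order_1 : A 1%nat = 1 /\
  forall w : C, Cmod w < r -> (g 1 w + w * (w * g 1 w ^ 3 * f 3 w) - 1)%C = 0.
Proof.
  assert (Cg := inverse_tail_continuous). assert (Cf := series_tail_continuous).
  destruct (vanishing_cofactor r (fun w => g 1 w + w * (w * g 1 w ^ 3 * f 3 w) - 1)%C Hr) as [V0 V].
  - solve_continuous.
  - intros w Hw. destruct (Hinv w Hw) as [_ E]. change (ps a (ps A w)) with (f 0 w) in E.
    rewrite (series_tail_unfold 0), (series_tail_unfold 1), (series_tail_unfold 2), a0, a1, a2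
      in E by exact Hw.
    apply (f_equal (fun z => z - w)%C) in E. replace (w - w)%C with (RtoC 0) in E by ring.
    rewrite <- E. simpl. ring.
  - rewrite inverse_tail_at_0 in V0. split; [|exact V]. apply Cminus_diag_uniq. rewrite <- V0. ring.
Qed.

Lemma inverse_order_2 : A 2%nat = 0 /\
  forall w : C, Cmod w < r -> (g 2 w + w * g 1 w ^ 3 * f 3 w)%C = 0.
Proof.
  destruct inverse_order_1 as [A1 V1].
  assert (Cg := inverse_tail_continuous). assert (Cf := series_tail_continuous).
  destruct (vanishing_cofactor r (fun w => g 2 w + w * g 1 w ^ 3 * f 3 w)%C Hr) as [V0 V].
  - solve_continuous.
  - intros w Hw. assert (U := inverse_tail_unfold 1 w Hw). rewrite A1 in U.
    transitivity (1 + w * g 2 w + w * (w * g 1 w ^ 3 * f 3 w) - 1)%C; [ring|].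
    rewrite <- U. now apply V1.
  - rewrite inverse_tail_at_0 in V0. split; [|exact V]. rewrite <- V0. ring.
Qed.

Lemma inverse_order_3 : A 3%nat = (- a 3%nat)%C /\
  forall w : C, Cmod w < r -> (g 3 w + g 1 w ^ 3 * f 3 w)%C = 0.
Proof.
  destruct inverse_order_1 as [A1 _], inverse_order_2 as [A2 V2].
  assert (Cg := inverse_tail_continuous). assert (Cf := series_tail_continuous).
  destruct (vanishing_cofactor r (fun w => g 3 w + g 1 w ^ 3 * f 3 w)%C Hr) as [V0 V].
  - solve_continuous.
  - intros w Hw. rewrite <- (V2 w Hw), (inverse_tail_unfold 2 w Hw), A2. ring.
  - rewrite !inverse_tail_at_0, series_tail_at_0, A1 in V0. split; [|exact V].
    apply Cminus_diag_uniq. rewrite <- V0. simpl. ring.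
Qed.

Lemma inverse_tail_1 (w : C) : Cmod w < r -> g 1 w = (1 + w * (w * g 3 w))%C.
Proof.
  intros Hw. destruct inverse_order_1 as [A1 _], inverse_order_2 as [A2 _].
  rewrite (inverse_tail_unfold 1 w Hw), (inverse_tail_unfold 2 w Hw), A1, A2. ring.
Qed.

(* [(g 1)^3 = 1 + w^2 cube_cofactor] and [(g 1)^4 = 1 + w^2 fourth_cofactor]. *)
Let cube_cofactor (w : C) : C :=
  (3 * g 3 w + w * w * (3 * g 3 w ^ 2 + w * w * g 3 w ^ 3))%C.

Let fourth_cofactor (w : C) : C := (cube_cofactor w * g 1 w + g 3 w)%C.

Lemma inverse_order_4 : A 4%nat = (- a 4%nat)%C /\
  forall w : C, Cmod w < r -> (g 4 w + w * cube_cofactor w * a 3%nat + g 1 w ^ 4 * f 4 w)%C = 0.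
Proof.
  destruct inverse_order_1 as [A1 _], inverse_order_3 as [A3 V3].
  assert (Cg := inverse_tail_continuous). assert (Cf := series_tail_continuous).
  destruct (vanishing_cofactor r (fun w =>
    g 4 w + w * cube_cofactor w * a 3%nat + g 1 w ^ 4 * f 4 w)%C Hr) as [V0 V].
  - unfold cube_cofactor. solve_continuous.
  - intros w Hw. rewrite <- (V3 w Hw).
    rewrite (inverse_tail_unfold 3 w Hw), A3, (series_tail_unfold 3 w Hw).
    transitivity (w * g 4 w + (w * w * cube_cofactor w) * a 3%nat
      + w * g 1 w ^ 4 * f 4 w)%C; [ring|].
    replace (w * w * cube_cofactor w)%C with (g 1 w ^ 3 - 1)%C; [simpl; ring|].
    unfold cube_cofactor. rewrite (inverse_tail_1 w Hw). simpl. ring.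
  - rewrite !inverse_tail_at_0, series_tail_at_0, A1, Cpow_1_l in V0. split; [|exact V].
    apply Cminus_diag_uniq. rewrite <- V0. ring.
Qed.

Lemma inverse_order_5 : A 5%nat = (3 * (a 3%nat * a 3%nat) - a 5%nat)%C.
Proof.
  destruct inverse_order_1 as [A1 _], inverse_order_3 as [A3 _], inverse_order_4 as [A4 V4].
  assert (Cg := inverse_tail_continuous). assert (Cf := series_tail_continuous).
  destruct (vanishing_cofactor r (fun w => g 5 w + cube_cofactor w * a 3%nat
    + w * fourth_cofactor w * a 4%nat + g 1 w ^ 5 * f 5 w)%C Hr) as [V0 V].
  - unfold fourth_cofactor, cube_cofactor. solve_continuous.
  - intros w Hw. rewrite <- (V4 w Hw).
    rewrite (inverse_tail_unfold 4 w Hw), A4, (series_tail_unfold 4 w Hw).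
    transitivity (w * g 5 w + w * cube_cofactor w * a 3%nat
      + (w * w * fourth_cofactor w) * a 4%nat + w * g 1 w ^ 5 * f 5 w)%C; [ring|].
    replace (w * w * fourth_cofactor w)%C with (g 1 w ^ 4 - 1)%C; [simpl; ring|].
    unfold fourth_cofactor, cube_cofactor. rewrite (inverse_tail_1 w Hw). simpl. ring.
  - rewrite inverse_tail_at_0, series_tail_at_0 in V0. unfold cube_cofactor in V0.
    rewrite !inverse_tail_at_0, A1, A3, Cpow_1_l in V0.
    apply Cminus_diag_uniq. rewrite <- V0. simpl. ring.
Qed.

End inverse_expansion.

Lemma bernoulli_le (r : R) (n : nat) : 0 < r < 1 -> 1 - r ^ n <= INR n * (1 - r).
Proof.
  intros Hr. induction n as [|n IH]; [simpl; lra|]. rewrite S_INR. simpl pow.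
  assert (0 <= r ^ n <= 1).
  { split; [apply pow_le; lra|]. rewrite <- (pow1 n). apply pow_incr. lra. }
  nra.
Qed.

Lemma le_1_of_mult_pow (x : R) (n : nat) : 0 <= x ->
  (forall r, 0 < r < 1 -> x * r ^ n <= 1) -> x <= 1.
Proof.
  intros Hx H. apply (le_of_vanishing_error _ _ (x * INR n)). intros r Hr.
  assert (B := Rmult_le_compat_l x _ _ Hx (bernoulli_le r n Hr)). specialize (H r Hr). lra.
Qed.

(* The coefficients of [f (r z) / r]. *)
Definition dilation (r : R) (a : nat -> C) (n : nat) : C := (a n * r ^ n / r)%C.

Lemma convergent_dilation (r : R) (a : nat -> C) : 0 < r ->
  convergent_on_disk 1 a -> convergent_on_disk (/ r) (dilation r a).
Proof.
  intros Hr Ha s Hs.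
  assert (E : forall n, / r * (Cmod (a n) * (r * s) ^ n) = Cmod (dilation r a n) * s ^ n).
  { intros n. unfold dilation.
    rewrite Cmod_div, Cmod_mult, Cmod_pow, Cmod_R, Rabs_pos_eq, Rpow_mult_distr
      by (lra || intros E; injection E; lra).
    field. lra. }
  apply (ex_series_ext _ _ E), (ex_series_scal (V := R_NormedModule)), Ha.
  assert (r * s < r * / r) by (apply Rmult_lt_compat_l; lra).
  rewrite Rinv_r in *; nra.
Qed.

Lemma ps_dilation (r : R) (a : nat -> C) (z : C) : 0 < r -> convergent_on_disk 1 a ->
  Cmod (r * z) < 1 -> ps (dilation r a) z = (ps a (r * z) / r)%C.
Proof.
  intros Hr Ha Hz. unfold Cdiv. rewrite Cmult_comm. unfold ps at 2.
  rewrite <- csum_scal by now apply ps_abs_summable with 1.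
  apply csum_ext. intros n. unfold dilation, Cdiv. rewrite Cpow_mult_l. ring.
Qed.

Section normalized_univalent.
Variable a : nat -> C.
Hypothesis Ha : convergent_on_disk 1 a.
Hypothesis a1 : a 1%nat = 1.
Hypothesis a2 : a 2%nat = 0.
Hypothesis Inj : forall z w, Cmod z < 1 -> Cmod w < 1 -> ps a z = ps a w -> z = w.

Lemma dilation_coefficient_bounds (r : R) : 0 < r < 1 ->
  Cmod (a 3%nat) ^ 2 * r ^ 4 <= 1 /\ 2 * Cmod (a 4%nat) ^ 2 * r ^ 6 <= 1 /\
  3 * Cmod (a 5%nat - a 3%nat * a 3%nat) ^ 2 * r ^ 8 <= 1.
Proof.
  intros Hr. assert (r0 : RtoC r <> 0) by (intros E; injection E; lra).
  assert (Disk : forall z, Cmod z < / r -> Cmod (r * z) < 1).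
  { intros z Hz. rewrite Cmod_mult, Cmod_R, Rabs_pos_eq by lra.
    apply (Rmult_lt_compat_l r) in Hz; [|lra]. rewrite Rinv_r in Hz; lra. }
  assert (Mr : forall c n, Cmod (c * r ^ n) ^ 2 = Cmod c ^ 2 * r ^ (2 * n)).
  { intros c n. rewrite Cmod_mult, Cmod_pow, Cmod_R, Rabs_pos_eq, pow_mult by lra.
    rewrite <- !pow_mult, Nat.mul_comm, pow_mult. ring. }
  destruct (univalent_coefficient_bounds (/ r) (dilation r a)) as (B3 & B4 & B5).
  - rewrite <- Rinv_1. apply Rinv_lt_contravar; lra.
  - apply convergent_dilation; [lra|exact Ha].
  - unfold dilation. rewrite a1. simpl. field. exact r0.
  - intros z w Hz Hw E. rewrite !ps_dilation in E by (auto; lra).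
    assert (E' : ps a (r * z) = ps a (r * w)).
    { transitivity (r * (ps a (r * z) / r))%C; [field; exact r0|]. rewrite E. field. exact r0. }
    apply Inj in E'; auto. transitivity (r * z / r)%C; [field; exact r0|].
    rewrite E'. field. exact r0.
  - unfold dilation. rewrite a2. unfold Cdiv. ring.
  - replace (dilation r a 3) with (a 3%nat * r ^ 2)%C in *
      by (unfold dilation; simpl; field; exact r0).
    replace (dilation r a 4) with (a 4%nat * r ^ 3)%C in *
      by (unfold dilation; simpl; field; exact r0).
    replace (dilation r a 5 - a 3%nat * r ^ 2 * (a 3%nat * r ^ 2))%C
      with ((a 5%nat - a 3%nat * a 3%nat) * r ^ 4)%C in B5
      by (unfold dilation; simpl; field; exact r0).
    rewrite !Mr in *. simpl Nat.mul in *. repeat split; lra.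
Qed.

Theorem univalent_disk_coefficient_bounds :
  Cmod (a 3%nat) ^ 2 <= 1 /\ 2 * Cmod (a 4%nat) ^ 2 <= 1 /\
  3 * Cmod (a 5%nat - a 3%nat * a 3%nat) ^ 2 <= 1.
Proof.
  assert (P := fun c => pow2_ge_0 (Cmod c)).
  repeat split;
    [apply (le_1_of_mult_pow _ 4)|apply (le_1_of_mult_pow _ 6)|apply (le_1_of_mult_pow _ 8)];
    try (apply dilation_coefficient_bounds; assumption).
  - apply P.
  - generalize (P (a 4%nat)). lra.
  - generalize (P (a 5%nat - a 3%nat * a 3%nat)%C). lra.
Qed.

End normalized_univalent.

Theorem inverse_coefficients (a A : nat -> C) :
  a 0%nat = 0 -> a 1%nat = 1 -> a 2%nat = 0 -> convergent_on_disk 1 a ->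
  (forall z w, Cmod z < 1 -> Cmod w < 1 -> ps a z = ps a w -> z = w) ->
  is_inverse_expansion a A ->
  A 3%nat = (- a 3%nat)%C /\ A 4%nat = (- a 4%nat)%C /\
  A 5%nat = (3 * (a 3%nat * a 3%nat) - a 5%nat)%C.
Proof.
  intros a0 a1 a2 Ha Inj (r & Hr & Inv).
  assert (HA : convergent_on_disk r A).
  { apply convergent_on_disk_of_pseries_sum. intros w Hw.
    destruct (Inv w Hw) as (g & Hg & _). now exists g. }
  assert (Hinv : forall w, Cmod w < r -> Cmod (ps A w) < 1 /\ ps a (ps A w) = w).
  { intros w Hw. destruct (Inv w Hw) as (g & Hg & Hg1 & Hfg).
    apply csum_unique in Hg, Hfg. fold (ps A w) in Hg. fold (ps a g) in Hfg. now subst g. }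
  assert (A0 : A 0%nat = 0).
  { destruct (Hinv 0) as [In E]; [now rewrite Cmod_0|].
    rewrite (ps_at_0 r A Hr HA) in In, E.
    apply Inj; rewrite ?Cmod_0; try lra.
    rewrite E, (ps_at_0 1) by (auto; lra). now rewrite a0. }
  split; [|split].
  - now apply (inverse_order_3 r a A).
  - now apply (inverse_order_4 r a A).
  - now apply (inverse_order_5 r a A).
Qed.

Lemma Cmod_hankel_le (x y b : C) :
  Cmod x ^ 2 <= 1 -> 2 * Cmod y ^ 2 <= 1 -> 3 * Cmod b ^ 2 <= 1 ->
  Cmod (x * b - 2 * (x * (x * x)) - y * y) <= 31 / 10.
Proof.
  intros Hx Hy Hb.
  assert (Px := Cmod_ge_0 x). assert (Py := Cmod_ge_0 y). assert (Pb := Cmod_ge_0 b).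
  assert (X1 : Cmod x <= 1) by nra. assert (B1 : Cmod b <= 6 / 10) by nra.
  eapply Rle_trans; [apply Cmod_minus_triangle|].
  assert (T := Cmod_minus_triangle (x * b) (2 * (x * (x * x)))).
  rewrite !Cmod_mult, Cmod_R, (Rabs_pos_eq 2) in * by lra.
  assert (X3 : Cmod x * (Cmod x * Cmod x) <= 1) by nra.
  assert (XB : Cmod x * Cmod b <= 6 / 10) by nra. nra.
Qed.

Lemma hankel_constant_ge : 31 / 10 <= sqrt 3 / (6 * sqrt 7) + 2 * sqrt 3.
Proof.
  assert (S3 : 17 / 10 <= sqrt 3).
  { rewrite <- (sqrt_square (17 / 10)) by lra. apply sqrt_le_1; lra. }
  assert (S7 : 0 < sqrt 7) by (apply sqrt_lt_R0; lra).
  assert (0 < sqrt 3 / (6 * sqrt 7)) by (apply Rdiv_lt_0_compat; lra). lra.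
Qed.

Theorem theorem2 (a A : nat -> C) :
  a 0%nat = RtoC 0 -> a 1%nat = RtoC 1 -> a 2%nat = RtoC 0 ->
  analytic_in_disk a -> univalent_in_disk a ->
  is_inverse_expansion a A ->
  Cmod (A 3%nat * A 5%nat - A 4%nat * A 4%nat)%C
    <= sqrt 3 / (6 * sqrt 7) + 2 * sqrt 3.
Proof.
  intros a0 a1 a2 Han Huni Hinv.
  assert (Ha : convergent_on_disk 1 a) by now apply convergent_on_disk_of_pseries_sum.
  assert (Inj : forall z w, Cmod z < 1 -> Cmod w < 1 -> ps a z = ps a w -> z = w).
  { intros z w Hz Hw E. apply (Huni z w (ps a z) (ps a w)); auto; now apply ps_correct with 1. }
  destruct (inverse_coefficients a A a0 a1 a2 Ha Inj Hinv) as (-> & -> & ->).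
  destruct (univalent_disk_coefficient_bounds a Ha a1 a2 Inj) as (B3 & B4 & B5).
  set (b := (a 5%nat - a 3%nat * a 3%nat)%C) in *.
  replace (- a 3%nat * (3 * (a 3%nat * a 3%nat) - a 5%nat) - - a 4%nat * - a 4%nat)%C
    with (a 3%nat * b - 2 * (a 3%nat * (a 3%nat * a 3%nat)) - a 4%nat * a 4%nat)%C
    by (unfold b; ring).
  apply Rle_trans with (31 / 10); [now apply Cmod_hankel_le|exact hankel_constant_ge].
Qed.
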